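(* Let $d_1,d_2\ge1$ be integers and let $F\in \Omega_2(d_1,d_2)$. Assume that $F$ has generalized cusps at (pairwise distinct) points $a_1,\ldots, a_r\in\mathbb{C}^2$. Then $$\sum^r_{i=1} \mu_{a_i}\le d_1^2+d_2^2+3d_1d_2-6d_1-6d_2+7,$$ where $\mu_{a_i}$ denotes the index of the generalized cusp of $F$ at $a_i$.
   Context: $\Omega_2(d_1,d_2)$ is the affine space of polynomial mappings $F=(f,g):\mathbb{C}^2\to\mathbb{C}^2$ with $\deg f\le d_1$, $\deg g\le d_2$. For a holomorphic mapping $F=(f,g)$ put $J(F)=f_xg_y-f_yg_x$ and $J_{1,1}(F)=J(F)_x\,f_y-J(F)_y\,f_x$. Generalized cusp: a holomorphic mapping germ $F_a:(\mathbb{C}^2,a)\to(\mathbb{C}^2,F(a))$ has a generalized cusp at $a$ if $F_a$ is proper (finite), the curve $J(F)=0$ is reduced near $a$, and the discriminant of $F_a$ (the image under $F_a$ of the germ of its critical set $\{J(F)=0\}$) is not smooth at $F(a)$ (in particular $a$ is a critical point). Index: if $F$ has a generalized cusp at $a$, then for a general linear mapping $T\in GL(2)$, writing $F'=(f',g')=T\circ F$, the gradient $\nabla f'$ does not vanish identically on any branch of $\{J(F)=0\}$ near $a$. The index of the generalized cusp of $F$ at $a$ is $$\mu_a:=\dim_{\mathbb{C}} \mathcal{O}_a/(J(F'), J_{1,1}(F'))-\dim_{\mathbb{C}} \mathcal{O}_a/(f'_x, f'_y),$$ where $\mathcal{O}_a$ is the ring of germs of holomorphic functions at $a$; this is well defined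 and finite. *)

(* Defs.v *)
(* MathComp-Analysis; the complex numbers are R[i] for any R : realType. *)
From HB Require Import structures.
From mathcomp Require Import all_boot all_order all_algebra.
From mathcomp Require Import boolp classical_sets functions reals topology.
From mathcomp Require Import normedtype sequences.
From mathcomp Require Import complex.
(* The notations of mpoly clash with those of MathComp-Analysis. *)
From mathcomp Require mpoly.
Import -(notations) mpoly.

Set Implicit Arguments.
Unset Strict Implicit.
Unset Printing Implicit Defensive.

Import Order.TTheory GRing.Theory Num.Theory.
Import numFieldNormedType.Exports.

Local Open Scope classical_set_scope.
Local Open Scope ring_scope.

(* Naming the structure (rather than using the bare R[i]) is what makes the
   topology of a numFieldType available on the complex numbers. *)
Definition Cplx (R : realType) : numClosedFieldType := R[i].

Section Polynomial_maps.
Variable C : comNzRingType.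
Definition polymap : Type := (mpoly 2 C * mpoly 2 C)%type.

Definition peval (p : mpoly 2 C) (x : C * C) : C :=
  meval (fun i => if i == ord0 then x.1 else x.2) p.

Definition eval_map (F : polymap) (x : C * C) : C * C :=
  (peval F.1 x, peval F.2 x).

Definition dx (p : mpoly 2 C) : mpoly 2 C := mderiv ord0 p.
Definition dy (p : mpoly 2 C) : mpoly 2 C := mderiv ord_max p.

(* msize is the total degree plus one, and 0 for the zero polynomial. *)
Definition Omega2 (d1 d2 : nat) : set polymap :=
  [set F | (msize F.1 <= d1.+1)%N /\ (msize F.2 <= d2.+1)%N].

Definition Jac (F : polymap) : mpoly 2 C :=
  dx F.1 * dy F.2 - dy F.1 * dx F.2.

Definition Jac11 (F : polymap) : mpoly 2 C :=
  dx (Jac F) * dy F.1 - dy (Jac F) * dx F.1.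

Definition lincomp (T : 'M[C]_2) (F : polymap) : polymap :=
  (T ord0 ord0 *: F.1 + T ord0 ord_max *: F.2,
   T ord_max ord0 *: F.1 + T ord_max ord_max *: F.2).

End Polynomial_maps.

Section Cusps.
Variable R : realType.
Local Notation C := (Cplx R).
Local Notation polymap := (polymap C).

(* The double power series with coefficients c, centred at a, converges
   absolutely to f in a neighbourhood of a. *)
Definition power_series_at (a : C * C) (c : nat -> nat -> C)
    (f : C * C -> C) : Prop :=
  \forall x \near a,
    let term i j := c i j * (x.1 - a.1) ^+ i * (x.2 - a.2) ^+ j in
    cvgn (fun n : nat => \sum_(i < n) \sum_(j < n) `|term i j|) /\
    (fun n : nat => \sum_(i < n) \sum_(j < n) term i j) @ \oo --> f x.

(* f represents an element of O_a, the ring of germs at a of holomorphic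
   (i.e. locally the sum of a convergent power series) functions.  Two
   functions represent the same germ iff they agree near a. *)
Definition holo_at (a : C * C) (f : C * C -> C) : Prop :=
  exists c, power_series_at a c f.

Definition germ_ideal1 (a : C * C) (g : C * C -> C) : set (C * C -> C) :=
  [set h | exists2 u, holo_at a u & \forall x \near a, h x = u x * g x].

Definition germ_ideal2 (a : C * C) (g1 g2 : C * C -> C) : set (C * C -> C) :=
  [set h | exists u v, [/\ holo_at a u, holo_at a v &
    \forall x \near a, h x = u x * g1 x + v x * g2 x]].

(* dim_C O_a / I = n : some e_0, ..., e_(n-1) in O_a induce a C-basis of
   O_a / I. *)
Definition germ_codim (a : C * C) (I : set (C * C -> C)) (n : nat) : Prop :=
  exists e : 'I_n -> C * C -> C, (forall i, holo_at a (e i)) /\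
    forall h, holo_at a h ->
      exists! c : 'rV[C]_n, I (fun x => h x - \sum_i c ord0 i * e i x).

Definition crit_set (F : polymap) : set (C * C) :=
  [set x | peval (Jac F) x = 0].

(* Some representative U -> V of the germ of F at a is a proper map. *)
Definition proper_germ (F : polymap) (a : C * C) : Prop :=
  exists U V : set (C * C),
    [/\ open U /\ U a, open V /\ V (eval_map F a), eval_map F @` U `<=` V &
        forall K, compact K -> K `<=` V -> compact (U `&` eval_map F @^-1` K)].

(* The curve g = 0 is reduced near a : the local rings O_b / (g) have no
   nonzero nilpotent, for all b near a. *)
Definition reduced_near (a : C * C) (g : C * C -> C) : Prop :=
  \forall b \near a, forall (h : C * C -> C) (n : nat), holo_at b h ->
    germ_ideal1 b g (fun x => h x ^+ n) -> germ_ideal1 b g h.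

(* D represents the image under F_a of the germ at a of the critical set: the
   images of all sufficiently small pieces of the critical set coincide with D
   near F(a). *)
Definition discriminant_germ (F : polymap) (a : C * C) (D : set (C * C)) :=
  exists2 U, nbhs a U & forall W, nbhs a W -> W `<=` U ->
    \forall y \near eval_map F a, D y <-> (eval_map F @` (W `&` crit_set F)) y.

(* Near b, D is the zero set of a holomorphic function h whose differential
   (c 1 0, c 0 1) at b does not vanish. *)
Definition smooth_curve_at (b : C * C) (D : set (C * C)) : Prop :=
  exists (c : nat -> nat -> C) (h : C * C -> C),
    [/\ power_series_at b c h, h b = 0, (c 1%N 0%N != 0) || (c 0%N 1%N != 0) &
        \forall y \near b, D y <-> h y = 0].

Definition generalized_cusp (F : polymap) (a : C * C) : Prop :=
  [/\ crit_set F a, proper_germ F a, reduced_near a (peval (Jac F)) &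
      exists2 D, discriminant_germ F a D & ~ smooth_curve_at (eval_map F a) D].

(* P holds for a general T in GL(2), i.e. on a nonempty Zariski open subset. *)
Definition for_general_GL2 (P : 'M[C]_2 -> Prop) : Prop :=
  exists2 q : mpoly (2 * 2) C, q != 0 &
    forall T : 'M[C]_2, T \in unitmx ->
      meval (fun k => mxvec T ord0 k) q != 0 -> P T.

Definition has_index (F : polymap) (a : C * C) (m : int) : Prop :=
  for_general_GL2 (fun T =>
    let F' := lincomp T F in
    exists p q : nat,
      [/\ germ_codim a (germ_ideal2 a (peval (Jac F')) (peval (Jac11 F'))) p,
          germ_codim a (germ_ideal2 a (peval (dx F'.1)) (peval (dy F'.1))) q &
          m = p%:Z - q%:Z]).

(* At most one m satisfies has_index F a m, and one does at every generalized
   cusp; elsewhere the value may be meaningless. *)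
Definition cusp_index (F : polymap) (a : C * C) : int := xget 0 (has_index F a).

End Cusps.

(* Main.v *)
Require Import Defs.
From HB Require Import structures.
From mathcomp Require Import all_boot all_order all_algebra.
From mathcomp Require Import boolp classical_sets functions reals topology.
From mathcomp Require Import normedtype sequences.
From mathcomp Require Import complex.
From mathcomp Require mpoly.
Import -(notations) mpoly.
From mathcomp Require Import zify ring.
Import Order.TTheory GRing.Theory Num.Theory.
Local Open Scope ring_scope.

(** Let f be the first component of T o F for a general T, let g be a component
    of F of least degree, which spans the same pencil together with f, and let e0, e1, e2 be the
    degrees of the gradients of f, g and J = J(F). The claimed bound is
    e0 e1 + e0 e2 + e1 e2.

    Local part. The index at a is the dimension of (f_x, f_y) / (J, J_{1,1}) in
    O_a. The map (u, v) |-> u f_x + v f_y from O_a^2 onto this quotient kills the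
    gradients of f, g and J, rotated by a right angle, so the index is at most
    the dimension of O_a^2 modulo these three rows. Since (J, J_{1,1}) has
    finite codimension, polynomial u and v suffice.

    Global part. Let N be the submodule of k[x,y]^2 spanned by three rows of
    degrees e0, e1, e2, cleared of their common factor, and let H be the
    greatest common divisor of their 2x2 minors, of degree at most h (h also counts the order of vanishing of
    the minors along the line at infinity). At the points considered H is a
    unit, so the local quotients are all detected by those u of degree at most n
    for which H divides det(u, row_i) for i = 0, 1, 2; counting dimensions for
    large n, with l <= h the degree of the common divisor of the first column,
    bounds their total dimension by
      (l^2 + (h - l)^2 + (e0 + e1 + e2 - h)^2 - e0^2 - e1^2 - e2^2) / 2,
    and l + (h - l) + (e0 + e1 + e2 - h) = e0 + e1 + e2. *)

Set Implicit Arguments.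
Unset Strict Implicit.
Unset Printing Implicit Defensive.

Lemma exists_min (T : Type) (P : T -> Prop) (f : T -> nat) (x : T) :
  P x -> exists2 y, P y & forall z, P z -> (f y <= f z)%N.
Proof.
move=> Px.
have ex : exists n, `[< exists2 y, P y & f y = n >].
  by exists (f x); apply/asboolP; exists x.
case: (ex_minnP ex) => n /asboolP[y Py <-] min_n.
by exists y => // z Pz; apply: min_n; apply/asboolP; exists z.
Qed.

(** * Primitive vectors over k[x][y] and removal of common factors *)

Section PrimitiveVectors.
Variable k : closedFieldType.
(* k[x][y]: the inner variable is x, the outer one y. *)
Local Notation R2 := {poly {poly k}}.

Definition spec (a : k) (p : R2) : {poly k} := map_poly (horner_eval a) p.

Lemma specM a p q : spec a (p * q) = spec a p * spec a q.
Proof. exact: rmorphM. Qed.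

Lemma spec_eq0 a p :
  spec a p = 0 -> exists p', p = ('X - a%:P)%:P * p'.
Proof.
move=> p0; exists (map_poly (fun c => c %/ ('X - a%:P)) p).
apply/polyP => i; rewrite coefCM coef_map_id0 ?div0p // mulrC divpK //.
have := congr1 (fun q : {poly k} => q`_i) p0.
by rewrite coef_map coef0 dvdp_XsubCl => /rootP.
Qed.

Lemma spec_polyC a (c : {poly k}) : spec a c%:P = c.[a]%:P.
Proof. by rewrite /spec map_polyC. Qed.

(* Gauss's lemma: since k is algebraically closed, a primitive vector is one
   that vanishes identically on no line x = a. *)
Lemma gauss (I : finType) (w u : I -> R2) (d : {poly k}) (q : R2) :
    (forall a, exists i, spec a (w i) != 0) -> d != 0 ->
    (forall i, d%:P * u i = q * w i) ->
  exists q', forall i, u i = q' * w i.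
Proof.
move=> prim_w; have [n] := ubnP (size d).
elim: n => // n IHn in d q *; rewrite ltnS => le_d_n d0 du.
have [/eqP/size_poly1P[c c0 def_d]|d1] := eqVneq (size d) 1.
  exists ((c^-1)%:P%:P * q) => i; rewrite -mulrA -du def_d mulrA -!polyCM.
  by rewrite mulVf // mul1r.
have [a /rootP da] := closed_rootP d d1.
have [i wi] := prim_w a.
have: spec a q * spec a (w i) = 0.
  by rewrite -specM -du specM spec_polyC da mul0r.
move/eqP; rewrite mulf_eq0 (negPf wi) orbF => /eqP/spec_eq0[q' def_q].
have : root d a by apply/rootP.
rewrite -dvdp_XsubCl => /dvdpP[d' def_d].
have d'0 : d' != 0 by apply: contraNneq d0 => d'0; rewrite def_d d'0 mul0r.
apply: (IHn d' q') => // [|j].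
  by apply: leq_trans le_d_n; rewrite def_d size_Mmonic ?monicXsubC // size_XsubC addn2.
have : ('X - a%:P)%:P * (d'%:P * u j) = ('X - a%:P)%:P * (q' * w j).
  by rewrite !mulrA -def_q -du def_d polyCM [d'%:P * _]mulrC.
by apply: mulfI; rewrite polyC_eq0 polyXsubC_eq0.
Qed.

(** For a nonzero [w] this is coprimality of the entries, phrased without gcds: a vector parallel to
    [w] over the fraction field is a polynomial multiple of it. *)
Definition primitive (I : Type) (w : I -> R2) :=
  forall (u : I -> R2) (d c : R2), d != 0 -> (forall i, d * u i = c * w i) ->
    exists q, forall i, u i = q * w i.

(** Among the vectors parallel to [w], minimize first the y-degree of the entry at [i0], then the
    x-degree of its leading coefficient. Pseudo-division by the minimal entry leaves no remainder,
    and Gauss's lemma clears the denominators it introduces. [G] is a greatest common divisor of the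
    entries. *)
Lemma primitive_vector (I : finType) (w : I -> R2) i0 : w i0 != 0 ->
  exists w' G, [/\ primitive w', w' i0 != 0, G != 0 & forall i, w i = G * w' i].
Proof.
move=> wi0.
pose P u := (forall i, u i * w i0 = u i0 * w i) /\ u i0 != 0.
have Pw : P w by split=> // i; rewrite mulrC.
have [u1 Pu1 min1] := exists_min (fun u : I -> R2 => size (u i0)) Pw.
pose P2 u := P u /\ (size (u i0) <= size (u1 i0))%N.
have P2u1 : P2 u1 by [].
have [v [[par_v v0] sz_v] min2] :=
  exists_min (fun u : I -> R2 => size (lead_coef (u i0))) P2u1.
(* A common factor x - a could be cancelled, which would shorten the leading coefficient of the
   entry at [i0]. *)
have prim_v a : exists i, spec a (v i) != 0.
  apply: contrapT => /forallNP v_a.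
  have {v_a} /choice[v' def_v] i : exists p, v i = ('X - a%:P)%:P * p.
    by apply: spec_eq0; apply/eqP/negPn/negP/v_a.
  have X0 : ('X - a%:P)%:P != 0 :> R2 by rewrite polyC_eq0 polyXsubC_eq0.
  have v'0 : v' i0 != 0 by move: v0; rewrite def_v mulf_eq0 negb_or => /andP[].
  have : P2 v'.
    split; first split=> // i.
      by apply: (mulfI X0); rewrite !mulrA -!def_v par_v.
    by apply: leq_trans sz_v; rewrite [v i0]def_v size_Cmul // polyXsubC_eq0.
  move/min2; rewrite leqNgt def_v lead_coefM lead_coefC mulrC.
  by rewrite size_Mmonic ?lead_coef_eq0 ?monicXsubC // size_XsubC addn2 /= ltnS leqnn.
have par_trans u : (forall i, u i * v i0 = u i0 * v i) ->
    forall i, u i * w i0 = u i0 * w i.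
  move=> par_u i; apply: (mulfI v0).
  by rewrite mulrCA mulrA par_u -mulrA par_v mulrCA.
have gen u : (forall i, u i * v i0 = u i0 * v i) ->
    exists q, forall i, u i = q * v i.
  move=> par_u.
  set d := lead_coef (v i0) ^+ scalp (u i0) (v i0).
  set q := u i0 %/ v i0.
  have d0 : d != 0 by rewrite expf_neq0 ?lead_coef_eq0.
  have du : d%:P * u i0 - q * v i0 = u i0 %% v i0.
    by rewrite mul_polyC Pdiv.Idomain.divp_eq addrC addKr.
  apply: (gauss (d := d) (q := q) prim_v d0) => i; apply/eqP; rewrite -subr_eq0.
  (* The entry of [t] at [i0] is a pseudo-remainder and [t] is parallel to [w], so minimality forces
     that entry to be 0, hence every entry. *)
  pose t i := d%:P * u i - q * v i.
  have par_t j : t j * v i0 = t i0 * v j.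
    by rewrite !mulrBl -!mulrA par_u [v j * _]mulrC.
  have [t0|t0] := eqVneq (t i0) 0.
    by move/eqP: (par_t i); rewrite t0 mul0r mulf_eq0 (negPf v0) orbF.
  have [] // : False.
  have : P t by split=> //; apply: par_trans.
  move/min1; rewrite leqNgt /t du => /negP; apply.
  by apply: leq_trans sz_v; rewrite ltn_modpN0.
have [G wG] : exists G, forall i, w i = G * v i.
  by apply: gen => i; rewrite mulrC -par_v mulrC.
exists v, G; split=> //; last first.
  by apply: contraNneq wi0 => G0; rewrite wG G0 mul0r.
move=> u d c d0 du; apply: gen => i; apply: (mulfI d0).
by rewrite !mulrA !du mulrAC.
Qed.

End PrimitiveVectors.

(** * Total degree in two variables *)

Section TotalDegree.
Variable k : fieldType.
Local Notation R2 := {poly {poly k}}.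

Implicit Types p q : R2.

Definition tle (n : nat) (p : R2) := forall i j, (n < i + j)%N -> p`_i`_j = 0.

(** The homogeneous part of degree [d] with x set to 1. It lives in a domain, so leading forms
    multiply without cancellation. *)
Definition topform (d : nat) (p : R2) : {poly k} :=
  \poly_(i < d.+1) p`_i`_(d - i).

Definition tdeg_is (d : nat) (p : R2) := tle d p /\ topform d p != 0.

Lemma tle0 n : tle n 0.
Proof. by move=> i j _; rewrite !coef0. Qed.

Lemma tleD n p q : tle n p -> tle n q -> tle n (p + q).
Proof. by move=> tp tq i j nij; rewrite !coefD tp ?tq ?addr0. Qed.

Lemma tleN n p : tle n p -> tle n (- p).
Proof. by move=> tp i j nij; rewrite !coefN tp ?oppr0. Qed.

Lemma tleW m n p : (m <= n)%N -> tle m p -> tle n p.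
Proof. by move=> le_mn tp i j /(leq_ltn_trans le_mn)/tp. Qed.

Lemma tleM m n p q : tle m p -> tle n q -> tle (m + n) (p * q).
Proof.
move=> tp tq i j lt_ij; rewrite coefM coef_sum big1 // => -[i1 /= lt_i1] _.
rewrite coefM big1 // => -[j1 /= lt_j1] _.
have [lt1|le1] := ltnP m (i1 + j1); first by rewrite tp ?mul0r.
by rewrite [q`_ _ `_ _]tq ?mulr0 //; lia.
Qed.

Lemma topformM m n p q : tle m p -> tle n q ->
  topform (m + n) (p * q) = topform m p * topform n q.
Proof.
move=> tp tq; apply/polyP => i; rewrite coef_poly coefM.
have [lt_i|le_i] := ltnP i (m + n).+1; last first.
  rewrite big1 // => -[i1 /= lt_i1] _; rewrite !coef_poly.
  by case: ltnP => [lt1|]; rewrite ?mul0r //; case: ltnP; rewrite ?mulr0 //; lia.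
rewrite coefM coef_sum; apply: eq_bigr => -[i1 /= lt_i1] _.
rewrite !coef_poly coefM.
have [lt1|le1] := ltnP i1 m.+1; last first.
  rewrite mul0r big1 // => -[j1 /= lt_j1] _.
  by rewrite tp ?mul0r //; lia.
have [lt2|le2] := ltnP (i - i1) n.+1; last first.
  rewrite mulr0 big1 // => -[j1 /= lt_j1] _.
  by rewrite [q`_ _`_ _]tq ?mulr0 //; lia.
have lt_j : (m - i1 < (m + n - i).+1)%N by lia.
rewrite (bigD1 (Ordinal lt_j)) //= big1 ?addr0 => [|[j1 /= lt_j1] ne_j1].
  by congr (_ * _`_ _); lia.
have {}ne_j1 : j1 != (m - i1)%N by apply: contraNneq ne_j1 => /= e; apply/eqP/val_inj.
have [lt3|le3] := ltnP m (i1 + j1); first by rewrite tp ?mul0r.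
by rewrite [q`_ _`_ _]tq ?mulr0 //; lia.
Qed.

Lemma tdeg_is_exists p : p != 0 -> exists d, tdeg_is d p.
Proof.
move=> p0; have [n tn] : exists n, tle n p.
  exists (size p + sizeY p)%N => i j lt_ij.
  have [lt_i|le_i] := ltnP i (size p); last by rewrite [p`_i]nth_default ?coef0.
  rewrite nth_default // (leq_trans (max_size_coefXY _ _)) //.
  by move: lt_ij lt_i; move: (size p) (sizeY p) => m n; lia.
elim: n tn => [|n IHn] tn.
  exists 0%N; split=> //; apply: contraNneq p0 => top0.
  apply/eqP/polyP => i; apply/polyP => j; rewrite !coef0.
  have [lt_ij|] := ltnP 0 (i + j); first exact: tn.
  rewrite leqn0 addn_eq0 => /andP[/eqP-> /eqP->].
  by have := congr1 (fun q : {poly k} => q`_0) top0; rewrite coef_poly coef0 subnn.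
have [top0|] := eqVneq (topform n.+1 p) 0; last by exists n.+1.
apply: IHn => i j lt_ij; have [/tn //|le_ij] := ltnP n.+1 (i + j).
have := congr1 (fun q : {poly k} => q`_i) top0; rewrite coef_poly coef0 ltnS.
have [-> ->] // : (i <= n.+1)%N /\ (n.+1 - i)%N = j.
by clear - lt_ij le_ij; lia.
Qed.

Lemma tdeg_is_le d n p : tdeg_is d p -> tle n p -> (d <= n)%N.
Proof.
move=> [_ top0] tn; rewrite leqNgt; apply: contraNN top0 => lt_nd.
apply/eqP/polyP => i; rewrite coef_poly coef0.
by case: ltnP => // lt_i; apply: tn; lia.
Qed.

Lemma tdeg_is_neq0 d p : tdeg_is d p -> p != 0.
Proof.
move=> [_]; apply: contraNneq => ->.
by apply/eqP/polyP => i; rewrite coef_poly !coef0 if_same.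
Qed.

Lemma tdeg_isM m n p q : tdeg_is m p -> tdeg_is n q -> tdeg_is (m + n) (p * q).
Proof.
by move=> [tp p0] [tq q0]; split; [apply: tleM|rewrite topformM // mulf_neq0].
Qed.

End TotalDegree.

(** * Degree bounds by possibly negative integers *)

Section IntegerDegreeBounds.
Variable k : fieldType.
Local Notation R2 := {poly {poly k}}.
Implicit Types p q : R2.

(* A negative bound n forces p = 0. *)
Definition tlz (n : int) (p : R2) :=
  forall i j : nat, n < (i + j)%:Z -> p`_i`_j = 0.

Lemma tlz_nat (n : nat) p : tlz n p <-> tle n p.
Proof. by split=> tp i j lt_ij; apply: tp; rewrite ltz_nat in lt_ij *. Qed.

Lemma tlz_lt0 n p : n < 0 -> tlz n p -> p = 0.
Proof.
move=> n0 tp; apply/polyP => i; apply/polyP => j; rewrite !coef0 tp //.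
exact: lt_le_trans n0 _.
Qed.

Lemma tlz0 n : tlz n 0.
Proof. by move=> i j _; rewrite !coef0. Qed.

Lemma tlzW m n p : m <= n -> tlz m p -> tlz n p.
Proof. by move=> le_mn tp i j /(le_lt_trans le_mn)/tp. Qed.

Lemma tlzD n p q : tlz n p -> tlz n q -> tlz n (p + q).
Proof. by move=> tp tq i j nij; rewrite !coefD tp ?tq ?addr0. Qed.

Lemma tlzN n p : tlz n p -> tlz n (- p).
Proof. by move=> tp i j nij; rewrite !coefN tp ?oppr0. Qed.

Lemma tlzB n p q : tlz n p -> tlz n q -> tlz n (p - q).
Proof. by move=> tp tq; apply/tlzD/tlzN. Qed.

Lemma tlzM m n r p q : tlz m p -> tlz n q -> r = m + n -> tlz r (p * q).
Proof.
move=> tp tq ->; case: m tp => m tp; last by rewrite (tlz_lt0 _ tp) // mul0r; apply: tlz0.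
case: n tq => n tq; last by rewrite (tlz_lt0 _ tq) // mulr0; apply: tlz0.
by apply/(tlz_nat (m + n))/tleM; apply/tlz_nat.
Qed.

Lemma tdeg_is_tlz (d : nat) p : tdeg_is d p -> tlz d p.
Proof. by case=> tp _; apply/tlz_nat. Qed.

Lemma tdeg_is_lez (d : nat) n p : tdeg_is d p -> tlz n p -> d%:Z <= n.
Proof.
move=> dp; case: n => n tn; first by apply: (tdeg_is_le dp); apply/tlz_nat.
by have := tdeg_is_neq0 dp; rewrite (tlz_lt0 _ tn) ?eqxx.
Qed.

Lemma tlz_divr (d : nat) n r p q :
  tdeg_is d p -> tlz n (q * p) -> r = n - d%:Z -> tlz r q.
Proof.
move=> dp tqp ->; have [->|q0] := eqVneq q 0; first exact: tlz0.
have [dq def_dq] := tdeg_is_exists q0.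
have := tdeg_is_lez (tdeg_isM def_dq dp) tqp.
rewrite PoszD => le_n; apply: tlzW (tdeg_is_tlz def_dq).
by rewrite lerBrDr.
Qed.

(** [l] is the least difference between [e i] and the exact degree of a nonzero entry. Some entry
    attains the lowered bound, so that later divisions by it lose nothing. *)
Lemma defect (I : Type) (w : I -> R2) (e : I -> int) :
    (exists i, w i != 0) -> (forall i, tlz (e i) (w i)) ->
  exists l : nat, (forall i, tlz (e i - l%:Z) (w i)) /\
    exists i d, tdeg_is d (w i) /\ e i = (d + l)%:Z.
Proof.
move=> [i /tdeg_is_exists[d0 def_d0]] tw.
pose P (x : I * nat) := tdeg_is x.2 (w x.1).
have Pi : P (i, d0) by [].
have [[i1 d1] P1 min1] := exists_min (fun x => `|e x.1 - x.2%:Z|%N) Pi.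
have le_d j d : tdeg_is d (w j) -> d%:Z <= e j by move/tdeg_is_lez; apply.
exists `|e i1 - d1%:Z|%N; split; last first.
  by exists i1, d1; split=> //; have := le_d _ _ P1 => /=; clear; lia.
move=> j; have [->|/tdeg_is_exists[d def_d]] := eqVneq (w j) 0; first exact: tlz0.
apply: tlzW (tdeg_is_tlz def_d); have := min1 (j, d) def_d.
by have := le_d _ _ P1; have := le_d _ _ def_d; rewrite /=; clear; lia.
Qed.

End IntegerDegreeBounds.

(** * Polynomials of bounded degree as finite-dimensional spaces *)

Section Truncation.
Variable k : fieldType.
Local Notation R2 := {poly {poly k}}.

(** Functions on this finite type model the polynomials of degree at most [n] as a [vectType], for
    which [\dim] is available. *)
Definition tri (n : nat) := {ij : 'I_n.+1 * 'I_n.+1 | (ij.1 + ij.2 <= n)%N}.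
Local Notation trunc n := {ffun tri n -> k^o}.

Lemma dim_ffun_regular (W : finType) : dim {ffun W -> k^o} = #|W|.
Proof. exact: muln1. Qed.

(** Doubled to stay in nat. Once the rows are reversed, row [i] contains i + 1 monomials. *)
Lemma dim_trunc n : (2 * \dim {:trunc n} = n.+1 * n.+2)%N.
Proof.
rewrite dimvf dim_ffun_regular card_sig.
have -> : #|[pred ij : 'I_n.+1 * 'I_n.+1 | (ij.1 + ij.2 <= n)%N]|
          = (\sum_(i < n.+1) i.+1)%N.
  rewrite -sum1_card.
  rewrite (eq_bigl (fun ij : 'I_n.+1 * 'I_n.+1 => true && (ij.1 + ij.2 <= n)%N)) //.
  rewrite -(pair_big_dep xpredT (fun i j : 'I_n.+1 => (i + j <= n)%N) (fun _ _ => 1%N)) /=.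
  rewrite (reindex_inj rev_ord_inj) /=; apply: eq_bigr => i _.
  rewrite sum1_card -[RHS](card_ord i.+1).
  have le_i : (i.+1 <= n.+1)%N by [].
  rewrite -[RHS](card_image (f := widen_ord le_i)); last first.
    by move=> x y /(congr1 val) /= /val_inj.
  apply: eq_card => j; rewrite -[LHS]/(n.+1 - i.+1 + j <= n)%N subSS.
  apply/idP/mapP => [le_j|[x _ ->] /=].
    have lt_j : (j < i.+1)%N by have := ltn_ord i; lia.
    by exists (Ordinal lt_j); [rewrite mem_enum|apply: val_inj].
  by have := ltn_ord i; have := ltn_ord x; lia.
elim: n => [|n IHn]; first by rewrite big_ord_recr big_ord0.
by rewrite big_ord_recr /= mulnDr IHn; lia.
Qed.

Definition of_trunc n (t : trunc n) : R2 :=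
  \poly_(i < n.+1) \poly_(j < n.+1 - i)
    oapp (fun ij => t ij : k) 0 (insub (inord i, inord j)).

Definition to_trunc n (p : R2) : trunc n :=
  [ffun ij : tri n => (p`_(val ij).1`_(val ij).2 : k^o)].

Lemma coef_of_trunc n (t : trunc n) i j : (of_trunc t)`_i`_j =
  if (i + j <= n)%N then oapp (fun ij => t ij : k) 0 (insub (inord i, inord j)) else 0.
Proof.
rewrite coef_poly; have [lt_i|le_i] := ltnP i n.+1; last first.
  by rewrite coef0 leqNgt (_ : n < i + j)%N //; lia.
by rewrite coef_poly ltn_subRL ltnS.
Qed.

Lemma tle_of_trunc n (t : trunc n) : tle n (of_trunc t).
Proof. by move=> i j; rewrite coef_of_trunc ltnNge => /negPf->. Qed.

Lemma to_truncK n p : tle n p -> of_trunc (to_trunc n p) = p.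
Proof.
move=> tp; apply/polyP => i; apply/polyP => j; rewrite coef_of_trunc.
case: leqP => [le_ij|/tp//]; case: insubP => [x _ def_x|] /=.
  by rewrite ffunE def_x /= !inordK //; lia.
by rewrite /= !inordK ?le_ij //; lia.
Qed.

Lemma of_truncK n (t : trunc n) : to_trunc n (of_trunc t) = t.
Proof.
apply/ffunP => x; rewrite ffunE coef_of_trunc (valP x) !inord_val.
by rewrite -surjective_pairing valK.
Qed.

Lemma of_trunc_linear n (c : k) (t u : trunc n) :
  of_trunc (c *: t + u) = c%:P%:P * of_trunc t + of_trunc u.
Proof.
apply/polyP => i; apply/polyP => j; rewrite !coefD !coefCM !coef_of_trunc.
by case: leqP => _; [case: insub => [x|] /=; rewrite ?ffunE|]; rewrite ?mulr0 ?addr0.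
Qed.

Lemma to_trunc_linear n (c : k) p q :
  to_trunc n (c%:P%:P * p + q) = c *: to_trunc n p + to_trunc n q.
Proof. by apply/ffunP => x; rewrite !ffunE !coefD !coefCM. Qed.

Lemma of_trunc0 n : of_trunc (0 : trunc n) = 0.
Proof.
apply/polyP => i; apply/polyP => j; rewrite coef_of_trunc !coef0.
by case: leqP => // _; case: insub => //= x; rewrite ffunE.
Qed.

Lemma linfun_exists (U V : vectType k) (f : U -> V) :
  linear f -> exists g : 'Hom(U, V), forall x, g x = f x.
Proof.
move=> lf; pose F : {linear U -> V} := HB.pack f (GRing.isLinear.Build k U V *:%R f lf).
by exists (linfun F) => x; rewrite lfunE.
Qed.

Lemma dim_limg_le (U V : vectType k) (f : 'Hom(U, V)) (A : {vspace U}) :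
  (\dim (f @: A) <= \dim A)%N.
Proof. by rewrite -(limg_ker_dim f A) leq_addl. Qed.

End Truncation.

(** * Cross products of triples *)

Definition o0 : 'I_3 := @Ordinal 3 0 isT.
Definition o1 : 'I_3 := @Ordinal 3 1 isT.
Definition o2 : 'I_3 := @Ordinal 3 2 isT.

Lemma ord3P (P : 'I_3 -> Prop) : P o0 -> P o1 -> P o2 -> forall i, P i.
Proof.
move=> P0 P1 P2 [[|[|[|//]]] lt_i].
- by rewrite (_ : Ordinal lt_i = o0) //; apply: val_inj.
- by rewrite (_ : Ordinal lt_i = o1) //; apply: val_inj.
- by rewrite (_ : Ordinal lt_i = o2) //; apply: val_inj.
Qed.

Section Cross.
Variable A : comNzRingType.
Implicit Types u v w : 'I_3 -> A.

Definition dot u v := u o0 * v o0 + u o1 * v o1 + u o2 * v o2.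

Definition cross u v (i : 'I_3) : A :=
  match val i with
  | 0 => u o1 * v o2 - u o2 * v o1
  | 1 => u o2 * v o0 - u o0 * v o2
  | _ => u o0 * v o1 - u o1 * v o0
  end.

(** Eliminating one coordinate between the two orthogonality relations gives each identity without
    division. It serves to find the syzygies of three rows. *)
Lemma cross_parallel u v w : dot w u = 0 -> dot w v = 0 ->
  forall i j, cross u v i * w j = w i * cross u v j.
Proof.
rewrite /dot => wu wv.
have e2 : w o2 * u o2 = - (w o0 * u o0 + w o1 * u o1).
  by apply/eqP; rewrite -addr_eq0 addrC wu.
have f2 : w o2 * v o2 = - (w o0 * v o0 + w o1 * v o1).
  by apply/eqP; rewrite -addr_eq0 addrC wv.
have p01 : cross u v o0 * w o1 = w o0 * cross u v o1.
  rewrite /cross /=.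
  transitivity (v o2 * (w o1 * u o1) - u o2 * (w o1 * v o1)); first by ring.
  rewrite (_ : w o1 * u o1 = - (w o2 * u o2) - w o0 * u o0); last by rewrite e2; ring.
  by rewrite (_ : w o1 * v o1 = - (w o2 * v o2) - w o0 * v o0); [ring|rewrite f2; ring].
have p02 : cross u v o0 * w o2 = w o0 * cross u v o2.
  rewrite /cross /=.
  transitivity (u o1 * (w o2 * v o2) - v o1 * (w o2 * u o2)); first by ring.
  by rewrite e2 f2; ring.
have p12 : cross u v o1 * w o2 = w o1 * cross u v o2.
  rewrite /cross /=.
  transitivity (v o0 * (w o2 * u o2) - u o0 * (w o2 * v o2)); first by ring.
  by rewrite e2 f2; ring.
by do 2![apply: ord3P]; rewrite ?p01 ?p02 ?p12 1?mulrC // -?p01 -?p02 -?p12 mulrC.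
Qed.

Lemma crossZl c u v i : cross (fun j => c * u j) v i = c * cross u v i.
Proof. by move: i; apply: ord3P; rewrite /cross /=; ring. Qed.

Lemma crossZr c u v i : cross u (fun j => c * v j) i = c * cross u v i.
Proof. by move: i; apply: ord3P; rewrite /cross /=; ring. Qed.

(** The vector triple product. It shows that det(u, row_i) is divisible by the common factor of the
    minors when u is a combination of the rows. *)
Lemma cross_cross u v w i :
  dot w u * v i - dot w v * u i = cross (cross u v) w i.
Proof. by move: i; apply: ord3P; rewrite /cross /dot /=; ring. Qed.

End Cross.

(** Entry [i] only involves the two other indices, whose degrees sum to the total minus [e i]. *)
Lemma tlz_cross (k : fieldType) (a b : 'I_3 -> {poly {poly k}}) (e : 'I_3 -> nat)
    (s t : int) (i : 'I_3) :
    (forall j, tlz ((e j)%:Z + s) (a j)) -> (forall j, tlz ((e j)%:Z + t) (b j)) ->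
  tlz ((e o0 + e o1 + e o2)%:Z - (e i)%:Z + s + t) (cross a b i).
Proof.
move=> ta tb; move: i; apply: ord3P; rewrite /cross /=; apply: tlzB.
- by apply: (tlzM (ta o1) (tb o2)); lia.
- by apply: (tlzM (ta o2) (tb o1)); lia.
- by apply: (tlzM (ta o2) (tb o0)); lia.
- by apply: (tlzM (ta o0) (tb o2)); lia.
- by apply: (tlzM (ta o0) (tb o1)); lia.
- by apply: (tlzM (ta o1) (tb o0)); lia.
Qed.

(** * The dimension count for a 3 x 2 matrix *)

Section DeterminantalBound.
Variable k : closedFieldType.
Local Notation R2 := {poly {poly k}}.
Local Notation trunc n := {ffun tri n -> k^o}.

(** Since both triples have the same sum, the linear and constant terms cancel. What remains is the
    difference of their second elementary symmetric functions, and that of [x], [y], [z] is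
    nonnegative. The bound on [n] makes the truncated subtractions exact. *)
Lemma triangular_count (w e0 e1 e2 x y z n d0 d1 d2 dx dy dz : nat) :
    (e0 + e1 + e2 = x + y + z)%N -> (e0 + e1 + e2 <= n)%N ->
    (2 * d0 = (n - e0).+1 * (n - e0).+2)%N ->
    (2 * d1 = (n - e1).+1 * (n - e1).+2)%N ->
    (2 * d2 = (n - e2).+1 * (n - e2).+2)%N ->
    (2 * dx = (n - x).+1 * (n - x).+2)%N ->
    (2 * dy = (n - y).+1 * (n - y).+2)%N ->
    (2 * dz = (n - z).+1 * (n - z).+2)%N ->
    (w + (d0 + d1 + d2) <= dx + dy + dz)%N ->
  (w <= e0 * e1 + e0 * e2 + e1 * e2)%N.
Proof.
move=> eq_e le_n.
have size_eq (d i : nat) : (i <= n)%N -> (2 * d = (n - i).+1 * (n - i).+2)%N ->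
    2 * d%:Z = (n%:Z - i%:Z + 1) * (n%:Z - i%:Z + 2).
  by move=> le_i /(congr1 Posz); rewrite !PoszM -!natz !mulrSr natrB //; clear; lia.
move=> /size_eq-/(_ ltac:(lia)) D0 /size_eq-/(_ ltac:(lia)) D1.
move=> /size_eq-/(_ ltac:(lia)) D2 /size_eq-/(_ ltac:(lia)) Dx.
move=> /size_eq-/(_ ltac:(lia)) Dy /size_eq-/(_ ltac:(lia)) Dz le_w.
have pos (i j : nat) : 0 <= i%:Z * j%:Z by [].
have : 2 * w%:Z <= 2 * (e0%:Z * e1%:Z + e0%:Z * e2%:Z + e1%:Z * e2%:Z)
                   - 2 * (x%:Z * y%:Z + x%:Z * z%:Z + y%:Z * z%:Z).
  have -> : 2 * (e0%:Z * e1%:Z + e0%:Z * e2%:Z + e1%:Z * e2%:Z)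
            - 2 * (x%:Z * y%:Z + x%:Z * z%:Z + y%:Z * z%:Z)
          = 2 * dx%:Z + 2 * dy%:Z + 2 * dz%:Z - 2 * d0%:Z - 2 * d1%:Z - 2 * d2%:Z.
    rewrite Dx Dy Dz D0 D1 D2.
    by have -> : z%:Z = e0%:Z + e1%:Z + e2%:Z - x%:Z - y%:Z; [lia|ring].
  by lia.
have := pos x y; have := pos x z; have := pos y z.
by clear; lia.
Qed.

(** [a] and [b] are the columns of the matrix. The map [Psi] below sends scalars and row
    coefficients to the combination of the vectors H (p j, q j) and of the rows. Its source has
    dimension #|W| plus three triangular numbers; its kernel and image are bounded by three
    others. *)
Lemma determinantal_bound (e : 'I_3 -> nat) (a b m : 'I_3 -> R2) (H : R2)
    (W : finType) (p q : W -> R2) :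
    (forall i, tlz (e i) (a i)) -> (forall i, tlz (e i) (b i)) ->
    primitive (fun s : bool * 'I_3 => if s.1 then a s.2 else b s.2) ->
    (exists i, tdeg_is (e i) (a i) \/ tdeg_is (e i) (b i)) ->
    H != 0 -> primitive m -> (exists i, m i != 0) ->
    (forall i, cross a b i = H * m i) ->
    (forall (c : W -> k) (A : 'I_3 -> R2),
       \sum_j (c j)%:P%:P * (H * p j) = dot A a ->
       \sum_j (c j)%:P%:P * (H * q j) = dot A b -> forall j, c j = 0) ->
  (#|W| <= e o0 * e o1 + e o0 * e o2 + e o1 * e o2)%N.
Proof.
move=> ta tb prim_ab exact_ab H0 prim_m m_neq0 def_m indep.
set s1 := (e o0 + e o1 + e o2)%N.
have t_cross i : tlz (s1%:Z - (e i)%:Z) (cross a b i).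
  have := @tlz_cross _ a b e 0 0 i; rewrite !addr0; apply=> j; rewrite addr0.
    exact: ta.
  exact: tb.
(* [h] counts the degree of [H] and the vanishing of the minors along the line at infinity; at [kh]
   the lowered bound is sharp. *)
have [h [t_m [kh [dh [deg_mh def_dh]]]]] :
    exists h : nat, (forall i, tlz (s1%:Z - (e i)%:Z - h%:Z) (m i)) /\
      exists i d, tdeg_is d (m i) /\ s1%:Z - (e i)%:Z = (d + h)%:Z.
  apply: (defect (e := fun i => s1%:Z - (e i)%:Z)) => // i.
  have [dH deg_H] := tdeg_is_exists H0.
  have := t_cross i; rewrite def_m mulrC => t_mH.
  by apply: tlzW (tlz_divr deg_H t_mH erefl); lia.
have t_H : tlz h H.
  by have := t_cross kh; rewrite def_m => /(tlz_divr deg_mh); apply; lia.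
have [ia a_neq0] : exists i, a i != 0.
  apply: contrapT => /forallNP a0; case: m_neq0 => i /negP[].
  have {}a0 j : a j = 0 by apply/eqP/negPn/negP/a0.
  rewrite -(mulrI_eq0 _ (mulfI H0)) -def_m; apply/eqP; move: i.
  by apply: ord3P; rewrite /cross /= !a0; ring.
(* [L] is the common divisor of the first column; [l] below is its degree plus the contribution of
   the line at infinity. *)
have [a' [L [prim_a' a'_neq0 L0 def_a]]] := primitive_vector a_neq0.
have [l [t_a' [kl [dl [deg_a'l def_dl]]]]] :
    exists l : nat, (forall i, tlz ((e i)%:Z - l%:Z) (a' i)) /\
      exists i d, tdeg_is d (a' i) /\ (e i)%:Z = (d + l)%:Z.
  apply: (defect (e := fun i => (e i)%:Z)); first by exists ia.
  move=> i; have [dL deg_L] := tdeg_is_exists L0.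
  have := ta i; rewrite def_a mulrC => t_aL.
  by apply: tlzW (tlz_divr deg_L t_aL erefl); lia.
have t_L : tlz l L.
  by have := ta kl; rewrite def_a => /(tlz_divr deg_a'l); apply; lia.
(* The minors of [a'] and [b] are parallel to the primitive [m], whence [H] splits as [L * g]. *)
have [g def_g] : exists g, forall i, cross a' b i = g * m i.
  apply: (prim_m _ L H L0) => i; rewrite -def_m -crossZl.
  by move: i; apply: ord3P; rewrite /cross /= !def_a.
have def_H : H = L * g.
  have [i mi] := m_neq0; apply: (mulIf mi); rewrite -def_m -mulrA -def_g -crossZl.
  by move: i mi; apply: ord3P => _; rewrite /cross /= !def_a.
have g0 : g != 0 by apply: contraNneq H0 => g0; rewrite def_H g0 mulr0.
have t_g : tlz (h%:Z - l%:Z) g.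
  have : tlz (s1%:Z - (e kh)%:Z - l%:Z) (g * m kh).
    rewrite -def_g; have := @tlz_cross _ a' b e (- l%:Z) 0 kh; rewrite addr0; apply=> // j.
    by rewrite addr0; apply: tb.
  by move/(tlz_divr deg_mh); apply; lia.
have le_lh : (l <= h)%N.
  have [dg deg_g] := tdeg_is_exists g0.
  by have := tdeg_is_lez deg_g t_g; lia.
have le_hs : (h <= s1)%N by lia.
have [n0 t_pq] : exists n0 : nat, forall j, tlz n0 (p j) /\ tlz n0 (q j).
  have bound (f : W -> R2) : exists n0 : nat, forall j, tlz n0 (f j).
    have /choice[d def_d] j : exists d : nat, tlz d (f j).
      have [->|/tdeg_is_exists[d /tdeg_is_tlz]] := eqVneq (f j) 0; last by exists d.
      by exists 0%N; apply: tlz0.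
    exists (\max_j d j)%N => j; apply: tlzW (def_d j).
    by rewrite lez_nat; apply: leq_bigmax.
  have [n1 t1] := bound p; have [n2 t2] := bound q.
  by exists (n1 + n2)%N => j; split; [apply: tlzW (t1 j)|apply: tlzW (t2 j)]; lia.
set n := (n0 + s1)%N.
have le_e i : (e i <= s1)%N by move: i; apply: ord3P; rewrite /s1; lia.
pose U : vectType k := ({ffun W -> k^o} *
  (trunc (n - e o0) * trunc (n - e o1) * trunc (n - e o2)))%type.
pose cof (x : U) (i : 'I_3) : R2 := match val i with
  | 0 => of_trunc x.2.1.1 | 1 => of_trunc x.2.1.2 | _ => of_trunc x.2.2 end.
have t_cof x i : tlz (n - e i)%N (cof x i).
  by move: i; apply: ord3P; apply/tlz_nat/tle_of_trunc.
have cof_lin c x y i : cof (c *: x + y) i = c%:P%:P * cof x i + cof y i.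
  by move: i; apply: ord3P; rewrite /cof /= of_trunc_linear.
pose comb (f : W -> R2) (c : 'I_3 -> R2) (x : U) : R2 :=
  \sum_j (x.1 j : k)%:P%:P * (H * f j) + dot (cof x) c.
have comb_lin f c d x y : comb f c (d *: x + y) = d%:P%:P * comb f c x + comb f c y.
  rewrite /comb /dot !cof_lin mulrDr mulr_sumr.
  rewrite (eq_bigr (fun j => d%:P%:P * ((x.1 j : k)%:P%:P * (H * f j))
                             + (y.1 j : k)%:P%:P * (H * f j))); last first.
    by move=> j _; rewrite /= !ffunE !polyCD mulrDl !polyCM !mulrA.
  by rewrite big_split /=; ring.
have t_comb f c x : (forall j, tlz n0 (f j)) -> (forall i, tlz (e i) (c i)) ->
    tlz n (comb f c x).
  move=> tf tc; apply: tlzD.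
    elim/big_ind: _ => [|u v|j _]; [exact: tlz0|exact: tlzD|].
    apply: (tlzW (m := h%:Z + n0%:Z)); first by clear - le_hs; rewrite /n; lia.
    rewrite mulrCA; apply: (tlzM t_H (n := n0)) => //.
    apply: (tlzM (m := 0) (n := n0)) => // i i'.
    rewrite coefC; case: i => [|i] /=; rewrite ?coef0 // coefC.
    by case: i'.
  rewrite /dot; do 2?apply: tlzD; apply: (tlzM (t_cof _ _) (tc _)).
  - by have := le_e o0; rewrite /n; clear; lia.
  - by have := le_e o1; rewrite /n; clear; lia.
  - by have := le_e o2; rewrite /n; clear; lia.
have t_p j : tlz n0 (p j) by case: (t_pq j).
have t_q j : tlz n0 (q j) by case: (t_pq j).
have [Psi PsiE] : exists Psi : 'Hom(U, (trunc n * trunc n)%type),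
    forall x, Psi x = (to_trunc n (comb p a x), to_trunc n (comb q b x)).
  by apply: linfun_exists => d x y; rewrite !comb_lin !to_trunc_linear.
have combK f c x : (forall j, tlz n0 (f j)) -> (forall i, tlz (e i) (c i)) ->
    of_trunc (to_trunc n (comb f c x)) = comb f c x.
  by move=> tf tc; apply/to_truncK/tlz_nat/t_comb.
have le_hn : (s1 - h <= n)%N by rewrite /n; clear; lia.
have to_trunc_mul N M (g1 : R2) : exists f : 'Hom(trunc N, trunc M),
    forall t, f t = to_trunc M (g1 * of_trunc t).
  apply: linfun_exists => d x y.
  by rewrite of_trunc_linear mulrDr mulrCA to_trunc_linear.
(* By independence the kernel consists of syzygies of the rows. These are parallel to the minors,
   hence multiples of [m]; the entry [kh] bounds the degree of the multiplier. *)
have ker_le : (\dim (fullv :&: lker Psi) <= \dim {:trunc (n - (s1 - h))})%N.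
  have [K KE] : exists K : 'Hom(trunc (n - (s1 - h)), U), forall t,
      K t = (0, (to_trunc _ (m o0 * of_trunc t), to_trunc _ (m o1 * of_trunc t),
                 to_trunc _ (m o2 * of_trunc t))).
    apply: linfun_exists => d x y.
    rewrite of_trunc_linear !mulrDr !(mulrCA _ d%:P%:P) !to_trunc_linear.
    by rewrite [RHS]surjective_pairing /= scaler0 addr0.
  apply: leq_trans (dim_limg_le K fullv); apply: dimvS.
  apply/subvP => x; rewrite memv_cap => /andP[_]; rewrite memv_ker PsiE.
  move=> /eqP[pa0 qb0]; have {pa0} pa0 : comb p a x = 0.
    by rewrite -combK // pa0 of_trunc0.
  have {qb0} qb0 : comb q b x = 0 by rewrite -combK // qb0 of_trunc0.
  have x10 : x.1 = 0.
    have dotN c : dot (fun i => - cof x i) c = - dot (cof x) c.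
      by rewrite /dot; ring.
    apply/ffunP => j; rewrite ffunE.
    apply: (indep (fun j => x.1 j) (fun i => - cof x i)); rewrite dotN.
      by apply/eqP; rewrite -addr_eq0; apply/eqP.
    by apply/eqP; rewrite -addr_eq0; apply/eqP.
  have sum0 f : \sum_j (x.1 j : k)%:P%:P * (H * f j) = 0.
    by rewrite big1 // => j _; rewrite x10 ffunE !polyC0 mul0r.
  have da0 : dot (cof x) a = 0 by rewrite -pa0 /comb sum0 add0r.
  have db0 : dot (cof x) b = 0 by rewrite -qb0 /comb sum0 add0r.
  have [al def_al] : exists al, forall i, cof x i = al * m i.
    apply: (prim_m _ (m kh) (cof x kh)); first exact: tdeg_is_neq0 deg_mh.
    move=> i; apply: (mulfI H0); rewrite mulrA -def_m (cross_parallel da0 db0).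
    by rewrite def_m mulrCA.
  have t_al : tle (n - (s1 - h)) al.
    apply: (iffLR (tlz_nat _ _)); have := t_cof x kh; rewrite def_al => /(tlz_divr deg_mh).
    by apply; have := le_e kh; clear - def_dh le_hs; rewrite /n; lia.
  apply/memv_imgP; exists (to_trunc _ al); rewrite ?memvf // KE to_truncK //.
  have := def_al o0; have := def_al o1; have := def_al o2; rewrite /cof /=.
  move: x10; case: x {pa0 qb0 sum0 da0 db0 def_al} => x1 [[x20 x21] x22] /= -> E2 E1 E0.
  by rewrite !(mulrC (m _)) -E0 -E1 -E2 !of_truncK.
(* For u in the image, [H] divides det(u, row_i): visibly for the vectors H (p j, q j), and through
   the minors for the rows. *)
have quot x : exists z : 'I_3 -> R2,
    (forall i, comb p a x * b i - comb q b x * a i = H * z i) /\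
    forall i, tlz (n%:Z + (e i)%:Z - h%:Z) (z i).
  exists (fun i => \sum_j (x.1 j : k)%:P%:P * (p j * b i - q j * a i)
                   + cross m (cof x) i); split=> i.
    rewrite mulrDr -crossZl (_ : cross _ _ i = cross (cross a b) (cof x) i); last first.
      by move: i; apply: ord3P; rewrite /cross /= -!def_m.
    rewrite -cross_cross /comb !mulrDl opprD addrACA; congr (_ + _).
    rewrite mulr_sumr !mulr_suml -sumrB; apply: eq_bigr => j _; ring.
  apply: tlzD.
    elim/big_ind: _ => [|u v|j _]; [exact: tlz0|exact: tlzD|].
    apply: (tlzM (m := 0) (n := n%:Z + (e i)%:Z - h%:Z)); last by rewrite add0r.
      by move=> i1 i2; rewrite coefC; case: i1 => [|i1] /=; rewrite ?coef0 // coefC; case: i2.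
    apply: (tlzW (m := n0%:Z + (e i)%:Z)); first by clear - le_hs; rewrite /n; lia.
    by apply: tlzB; [apply: (tlzM (t_p j) (tb i))|apply: (tlzM (t_q j) (ta i))].
  have t_mc j j' : (e i + e j + e j' = s1)%N ->
      tlz (n%:Z + (e i)%:Z - h%:Z) (m j * cof x j').
    move=> eq_s; apply: (tlzM (t_m j) (t_cof x j')).
    by have := le_e j'; clear - eq_s; rewrite /n; lia.
  by move: i t_mc; apply: ord3P => t_mc; rewrite /cross /=; apply: tlzB; apply: t_mc;
    rewrite /s1; clear; lia.
have [pr1 pr1E] : exists f : 'Hom((trunc n * trunc n)%type, trunc n),
    forall x, f x = x.1 by apply: linfun_exists.
have img_le : (\dim (pr1 @: limg Psi) <= \dim {:trunc (n - l)})%N.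
  have [M ME] := to_trunc_mul (n - l)%N n L.
  apply: leq_trans (dim_limg_le M fullv); apply: dimvS.
  apply/subvP => _ /memv_imgP[_ /memv_imgP[x _ ->] ->].
  rewrite pr1E PsiE /=; have [z [def_z t_z]] := quot x.
  have t_u1 : tlz n (comb p a x) by apply: t_comb.
  have t_u2 : tlz n (comb q b x) by apply: t_comb.
  move: (comb p a x) (comb q b x) t_u1 t_u2 def_z => u1 u2 t_u1 t_u2 def_z.
  (* Times [L], the vector on the left is [u1] times the whole matrix, because [L * g] is [H].
     Primitivity of the matrix gives [y], and then [u1 = L * y]. *)
  have [y def_y] : exists y, forall s : bool * 'I_3,
      (if s.1 then u1 * a' s.2 else u2 * a' s.2 + g * z s.2)
      = y * (if s.1 then a s.2 else b s.2).
    apply: (prim_ab _ L u1 L0) => -[[] i] /=; first by rewrite def_a mulrCA.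
    rewrite mulrDr mulrCA -def_a [L * (g * _)]mulrA -def_H -def_z; ring.
  have y_a i : y * a i = u1 * a' i by rewrite -(def_y (true, i)).
  have y_b i : y * b i = u2 * a' i + g * z i by rewrite -(def_y (false, i)).
  have def_u1 : u1 = L * y.
    apply: (mulIf a_neq0); rewrite -[in RHS]mulrA y_a def_a; ring.
  have t_y : tle (n - l) y.
    apply: (iffLR (tlz_nat _ _)).
    have [i [deg_i|deg_i]] := exact_ab.
      have : tlz (n%:Z + ((e i)%:Z - l%:Z)) (y * a i).
        by rewrite y_a; apply: (tlzM t_u1 (t_a' i)).
      by move/(tlz_divr deg_i); apply; clear - le_lh le_hs; rewrite /n; lia.
    have : tlz (n%:Z + ((e i)%:Z - l%:Z)) (y * b i).
      rewrite y_b; apply: tlzD; first exact: (tlzM t_u2 (t_a' i)).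
      by apply: (tlzM t_g (t_z i)); ring.
    by move/(tlz_divr deg_i); apply; clear - le_lh le_hs; rewrite /n; lia.
  by apply/memv_imgP; exists (to_trunc _ y); rewrite ?memvf // ME to_truncK // def_u1.
(* When the first component is 0, divisibility reads u2 a_i = - H z_i; after cancelling [L],
   primitivity of [a'] makes [u2] a multiple of [g]. *)
have ker1_le : (\dim (limg Psi :&: lker pr1) <= \dim {:trunc (n - (h - l))})%N.
  have [M ME] := to_trunc_mul (n - (h - l))%N n g.
  have [M2 M2E] : exists f : 'Hom(trunc (n - (h - l)), (trunc n * trunc n)%type),
      forall t, f t = (0, M t).
    apply: linfun_exists => d x y; rewrite linearP.
    by rewrite [RHS]surjective_pairing /= scaler0 addr0.
  apply: leq_trans (dim_limg_le M2 fullv); apply: dimvS.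
  apply/subvP => v; rewrite memv_cap memv_ker pr1E => /andP[/memv_imgP[x _ ->]].
  rewrite PsiE /= => /eqP u10; have {u10} u10 : comb p a x = 0.
    by rewrite -combK // u10 of_trunc0.
  have [z [def_z t_z]] := quot x; rewrite u10 in def_z *.
  move: (comb q b x) def_z => u2 def_z.
  have [y def_y] : exists y, forall i, - z i = y * a' i.
    apply: (prim_a' _ g u2 g0) => i; apply: (mulfI L0).
    by rewrite mulrA -def_H mulrN -def_z def_a; ring.
  have def_u2 : u2 = g * y.
    apply: (mulIf a_neq0); rewrite def_a -mulrA [y * _]mulrCA -def_y.
    have := def_z ia; rewrite mul0r sub0r def_H def_a => E.
    by rewrite !mulrN -mulrA in E *; rewrite [g * _]mulrCA -E; ring.
  have t_y : tle (n - (h - l)) y.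
    apply: (iffLR (tlz_nat _ _)); have := tlzN (t_z kl); rewrite def_y.
    by move/(tlz_divr deg_a'l); apply; clear - le_lh le_hs def_dl; rewrite /n; lia.
  apply/memv_imgP; exists (to_trunc _ y); rewrite ?memvf // M2E ME to_truncK //.
  by rewrite def_u2; congr (_, _); apply/ffunP => j; rewrite !ffunE !coef0.
have dimU : \dim {:U} = (#|W| + (\dim {:trunc (n - e o0)} +
    \dim {:trunc (n - e o1)} + \dim {:trunc (n - e o2)}))%N.
  by rewrite !dimvf -(dim_ffun_regular k W).
apply: (@triangular_count _ _ _ _ l (h - l) (s1 - h) n _ _ _ _ _ _ _ _
  (dim_trunc k _) (dim_trunc k _) (dim_trunc k _) (dim_trunc k _) (dim_trunc k _)
  (dim_trunc k _)).
- by clear - le_lh le_hs; rewrite -/s1; lia.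
- by clear; rewrite -/s1 /n; lia.
rewrite -dimU -(limg_ker_dim Psi fullv) -(limg_ker_dim pr1 (limg Psi)).
rewrite addnC leq_add // addnC leq_add //.
Qed.

End DeterminantalBound.

(** * Combining finitely many points *)

Section ManyPoints.
Variable k : closedFieldType.
Local Notation R2 := {poly {poly k}}.

Definition ev (p : R2) (x : k * k) : k := p.[x.2%:P].[x.1].

Lemma evM p q x : ev (p * q) x = ev p x * ev q x.
Proof. by rewrite /ev !hornerM. Qed.

Lemma evD p q x : ev (p + q) x = ev p x + ev q x.
Proof. by rewrite /ev !hornerD. Qed.

Lemma evC c x : ev c%:P%:P x = c.
Proof. by rewrite /ev !hornerC. Qed.

Lemma ev1 x : ev 1 x = 1.
Proof. exact: evC. Qed.

Lemma ev_exp p n x : ev (p ^+ n) x = ev p x ^+ n.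
Proof. by elim: n => [|n IHn]; rewrite ?ev1 // !exprS evM IHn. Qed.

Definition lineX (c : k) : R2 := ('X - c%:P)%:P.
Definition lineY (c : k) : R2 := 'X - c%:P%:P.

Lemma ev_lineX c x : ev (lineX c) x = x.1 - c.
Proof. by rewrite /ev hornerC hornerXsubC. Qed.

Lemma ev_lineY c x : ev (lineY c) x = x.2 - c.
Proof. by rewrite /ev hornerXsubC -polyCB hornerC. Qed.

(** [U i u v] stands for the vanishing of (u, v) in the local quotient at [pt i]. As in the Chinese
    remainder theorem, local pairs are multiplied by polynomials that are nonzero at their own point
    and annihilate the other quotients, so that they become independent together. *)
Lemma many_points_bound (I : finType) (pt : I -> k * k) (e : 'I_3 -> nat)
    (a b : 'I_3 -> R2) (U : I -> R2 -> R2 -> Prop) (mu : I -> nat) :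
    injective pt ->
    (forall i, tle (e i) (a i)) -> (forall i, tle (e i) (b i)) ->
    (forall i u v u' v', U i u v -> U i u' v' -> U i (u + u') (v + v')) ->
    (forall i c u v, U i u v -> U i (c * u) (c * v)) ->
    (forall i j, U i (a j) (b j)) ->
    (forall i s u v, ev s (pt i) != 0 -> U i (s * u) (s * v) -> U i u v) ->
    (forall i H c c', cross a b o1 = H * c -> cross a b o2 = H * c' ->
       forall u v, U i (H * u) (H * v) -> U i u v) ->
    (forall i, exists N, forall u v,
       U i (lineX (pt i).1 ^+ N * u) (lineX (pt i).1 ^+ N * v) /\
       U i (lineY (pt i).2 ^+ N * u) (lineY (pt i).2 ^+ N * v)) ->
    (forall i, exists p q : 'I_(mu i) -> R2, forall c : 'I_(mu i) -> k,
       U i (\sum_l (c l)%:P%:P * p l) (\sum_l (c l)%:P%:P * q l) ->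
       forall l, c l = 0) ->
  (\sum_i mu i <= e o0 * e o1 + e o0 * e o2 + e o1 * e o2)%N.
Proof.
move=> pt_inj ta tb UD UM Uab Uunit Udiv Unil Uind.
have U0 i : U i 0 0 by have := UM i 0 _ _ (Uab i o0); rewrite !mul0r.
have U_sum i (J : finType) (P : pred J) (f g : J -> R2) :
    (forall j, P j -> U i (f j) (g j)) -> U i (\sum_(j | P j) f j) (\sum_(j | P j) g j).
  by move=> Ufg; elim/big_rec2: _ => // j u v Pj; apply: UD; apply: Ufg.
have mu0 i : (forall u v, U i u v) -> mu i = 0%N.
  move=> Ui; apply/eqP/negPn/negP; rewrite -lt0n => mui.
  have [p [q /(_ (fun=> 1) (Ui _ _) (Ordinal mui))/eqP]] := Uind i.
  by rewrite oner_eq0.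
(* If all minors vanish, [Udiv] with [H = 0] makes every local quotient trivial. *)
have [[i0 cr_neq0]|cr0] := pselect (exists i, cross a b i != 0); last first.
  have {}cr0 i : cross a b i = 0 by apply/eqP/negPn/negP => ?; apply: cr0; exists i.
  rewrite big1 // => i _; apply: mu0 => u v; apply: (Udiv i 0 0 0).
  - by rewrite cr0 mul0r.
  - by rewrite cr0 mul0r.
  - by rewrite !mul0r.
pose ab (s : bool * 'I_3) := if s.1 then a s.2 else b s.2.
have [s0 ab0] : exists s, ab s != 0.
  apply: contrapT => /forallNP ab0; case/negP: cr_neq0.
  have a0 j : a j = 0 by apply/eqP/negPn/negP/(ab0 (true, j)).
  by apply/eqP; move: i0; apply: ord3P; rewrite /cross /= !a0; ring.
(* Divide the whole matrix by its common divisor; the degree bounds drop by the defect [l]. *)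
have [ab' [G [prim_ab' ab'0 G0 def_ab]]] := primitive_vector ab0.
have [l [t_ab' [sl [dl [deg_sl def_dl]]]]] :
    exists l : nat, (forall s, tlz ((e s.2)%:Z - l%:Z) (ab' s)) /\
      exists s d, tdeg_is d (ab' s) /\ (e s.2)%:Z = (d + l)%:Z.
  apply: (defect (e := fun s : bool * 'I_3 => (e s.2)%:Z)); first by exists s0.
  move=> s; have [dG deg_G] := tdeg_is_exists G0.
  have : tlz (e s.2) (ab s) by apply/tlz_nat; rewrite /ab; case: ifP.
  rewrite def_ab mulrC => t_abG.
  by apply: tlzW (tlz_divr deg_G t_abG erefl); lia.
pose a' i := ab' (true, i); pose b' i := ab' (false, i).
have def_a i : a i = G * a' i by rewrite -def_ab.
have def_b i : b i = G * b' i by rewrite -def_ab.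
have def_cr i : cross a b i = G * (G * cross a' b' i).
  by rewrite -crossZr -crossZl; move: i; apply: ord3P; rewrite /cross /= !def_a !def_b.
have cr'_neq0 : cross a' b' i0 != 0.
  by apply: contraNneq cr_neq0 => cr'0; rewrite def_cr cr'0 !mulr0.
have [m [H [prim_m m0 H0 def_m]]] := primitive_vector cr'_neq0.
have UdivG i u v : U i (G * u) (G * v) -> U i u v.
  by apply: Udiv; rewrite ?[RHS]def_cr; apply: def_cr.
have UdivH i u v : U i (H * u) (H * v) -> U i u v.
  apply: (Udiv i H (G * (G * m o1)) (G * (G * m o2))); rewrite def_cr def_m; ring.
have Uab' i j : U i (a' j) (b' j) by apply: UdivG; rewrite -def_a -def_b.
(* [s i] is a product, over the other points, of a power of a vertical or horizontal line through
   that point that misses [pt i]. *)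
have /choice[s s_spec] i : exists s, ev s (pt i) != 0 /\
    forall j, j != i -> forall u v, U j (s * u) (s * v).
  have /choice[t t_spec] j : exists t, ev t (pt i) != 0 /\
      (j != i -> forall u v, U j (t * u) (t * v)).
    have [->|ne_ji] := eqVneq j i; first by exists 1; rewrite ev1 oner_eq0.
    have [N nil] := Unil j.
    have [eq1|ne1] := eqVneq (pt j).1 (pt i).1; last first.
      exists (lineX (pt j).1 ^+ N); split=> [|_ u v]; last by case: (nil u v).
      by rewrite ev_exp ev_lineX expf_neq0 // subr_eq0 eq_sym.
    exists (lineY (pt j).2 ^+ N); split=> [|_ u v]; last by case: (nil u v).
    rewrite ev_exp ev_lineY expf_neq0 // subr_eq0 eq_sym.
    apply: contraNneq ne_ji => eq2; apply/eqP/pt_inj.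
    by rewrite [LHS]surjective_pairing [RHS]surjective_pairing eq1 eq2.
  exists (\prod_j t j); split.
    elim/big_ind: _ => [|u v u0 v0|j _]; first by rewrite ev1 oner_eq0.
      by rewrite evM mulf_neq0.
    by have [] := t_spec j.
  move=> j ne_ji u v; rewrite (bigD1 j) //= -!mulrA.
  by have [_] := t_spec j; apply.
pose p i := sval (cid (Uind i)).
pose q i := sval (cid (svalP (cid (Uind i)))).
have indep i := svalP (cid (svalP (cid (Uind i)))).
pose W := {i : I & 'I_(mu i)}.
have cardW : #|{: W}| = (\sum_i mu i)%N.
  rewrite -sum1_card -(sig_big_dep xpredT (fun i => xpredT) (fun i (_ : 'I_(mu i)) => 1%N)) /=.
  by apply: eq_bigr => i _; rewrite sum1_card card_ord.
rewrite -cardW.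
pose e' i := (e i - l)%N.
apply: (leq_trans (n := e' o0 * e' o1 + e' o0 * e' o2 + e' o1 * e' o2)).
  apply: (@determinantal_bound k e' a' b' m H W
    (fun w => s (tag w) * p (tag w) (tagged w))
    (fun w => s (tag w) * q (tag w) (tagged w))) => //.
  - by move=> i; apply: tlzW (t_ab' (true, i)); rewrite /e' /=; clear; lia.
  - by move=> i; apply: tlzW (t_ab' (false, i)); rewrite /e' /=; clear; lia.
  - move=> u d c d0 du; have du' x : d * u x = c * ab' x.
      by case: x (du x) => -[] i.
    have [y def_y] := prim_ab' u d c d0 du'.
    by exists y => -[[] i]; rewrite def_y.
  - have def_e' : e' sl.2 = dl by rewrite /e'; lia.
    by exists sl.2; rewrite def_e'; case: sl deg_sl {def_dl def_e'} => -[] i; [left|right].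
  - by exists i0.
  move=> c A eqa eqb [j j'].
  have U_all : U j (dot A a') (dot A b').
    by apply: (UD j); [apply: (UD j)|]; apply: (UM j).
  pose F (r : forall i, 'I_(mu i) -> R2) i :=
    \sum_(x : 'I_(mu i)) (c (Tagged (fun i => 'I_(mu i)) x))%:P%:P * (H * (s i * r i x)).
  have splitF r : \sum_w (c w)%:P%:P * (H * (s (tag w) * r (tag w) (tagged w)))
      = F r j + \sum_(i | i != j) F r i.
    transitivity (\sum_i F r i); last by rewrite (bigD1 j).
    rewrite /F sig_big_dep /=; apply: eq_bigr => -[] //.
  have FE r i : F r i =
      H * (s i * \sum_x (c (Tagged (fun i => 'I_(mu i)) x))%:P%:P * r i x).
    by rewrite /F !mulr_sumr; apply: eq_bigr => x _; ring.
  (* The full combination lies in [U j] as a combination of rows; the parts from the other points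
     are annihilated at [j] and can be subtracted. *)
  have U_j : U j (F p j) (F q j).
    have -> : F p j = dot A a' + -1 * \sum_(i | i != j) F p i.
      by rewrite -eqa splitF mulN1r addrK.
    have -> : F q j = dot A b' + -1 * \sum_(i | i != j) F q i.
      by rewrite -eqb splitF mulN1r addrK.
    apply: UD => //; apply: UM; apply: U_sum => i ne_ij.
    rewrite !FE [H * (_ * _)]mulrCA [H * (s i * \sum_x _ * q i x)]mulrCA.
    by have [_] := s_spec i; apply; rewrite eq_sym.
  move: U_j; rewrite !FE => /UdivH/Uunit-/(_ (s_spec j).1)/indep.
  by apply.
by rewrite !leq_add // leq_mul // leq_subr.
Qed.

End ManyPoints.

(** * Absolutely summable double series of complex numbers *)

Section DoubleSeries.
Variable R : realType.
Local Notation C := (Cplx R).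
Import numFieldNormedType.Exports.
Local Open Scope classical_set_scope.

Definition sqsum (t : nat -> nat -> C) (n : nat) : C :=
  \sum_(i < n) \sum_(j < n) t i j.

Definition abssum (t : nat -> nat -> C) : nat -> C := sqsum (fun i j => `|t i j|).

(** Boundedness passes at once to dominated families; monotone convergence recovers the limits. *)
Definition summable2 (t : nat -> nat -> C) := exists M, forall n, abssum t n <= M.

Lemma sqsumD t u n : sqsum (fun i j => t i j + u i j) n = sqsum t n + sqsum u n.
Proof. by rewrite /sqsum -big_split /=; apply: eq_bigr => i _; rewrite -big_split. Qed.

Lemma sqsumZ c t n : sqsum (fun i j => c * t i j) n = c * sqsum t n.
Proof. by rewrite /sqsum mulr_sumr; apply: eq_bigr => i _; rewrite mulr_sumr. Qed.

Lemma sqsum_ext t u n : (forall i j, t i j = u i j) -> sqsum t n = sqsum u n.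
Proof. by move=> tu; apply: eq_bigr => i _; apply: eq_bigr. Qed.

Lemma ler_sqsum t u n : (forall i j, t i j <= u i j) -> sqsum t n <= sqsum u n.
Proof. by move=> tu; apply: ler_sum => i _; apply: ler_sum. Qed.

Lemma sqsum_ge0 t n : (forall i j, 0 <= t i j) -> 0 <= sqsum t n.
Proof. by move=> t0; apply: sumr_ge0 => i _; apply: sumr_ge0. Qed.

Lemma abssum_ge0 t n : 0 <= abssum t n.
Proof. exact: sqsum_ge0. Qed.

Lemma sqsumS t n : sqsum t n.+1 =
  sqsum t n + \sum_(i < n) t i n + \sum_(j < n.+1) t n j.
Proof.
rewrite /sqsum big_ord_recr /=; congr (_ + _).
by rewrite -big_split /=; apply: eq_bigr => i _; rewrite big_ord_recr.
Qed.

Lemma sqsum_incr t n : (forall i j, 0 <= t i j) -> sqsum t n <= sqsum t n.+1.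
Proof.
by move=> t0; rewrite sqsumS -addrA lerDl addr_ge0 // sumr_ge0.
Qed.

Lemma abssum_homo t : {homo abssum t : m n / (m <= n)%N >-> m <= n}.
Proof. by apply/nondecreasing_seqP => n; apply: sqsum_incr. Qed.

Lemma summable2_le t u : (forall i j, `|t i j| <= u i j) -> summable2 u -> summable2 t.
Proof.
move=> tu [M uM]; exists M => n; apply: le_trans (uM n).
by apply: ler_sqsum => i j; rewrite [leRHS]ger0_norm // (le_trans _ (tu i j)).
Qed.

Lemma summable2_norm t : summable2 t -> summable2 (fun i j => `|t i j|).
Proof.
move=> [M tM]; exists M => n; rewrite (_ : abssum _ n = abssum t n) //.
by apply: sqsum_ext => i j; rewrite normr_id.
Qed.

Lemma summable2D t u : summable2 t -> summable2 u ->
  summable2 (fun i j => t i j + u i j).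
Proof.
move=> [M tM] [N uN]; exists (M + N) => n.
apply: le_trans (lerD (tM n) (uN n)); rewrite -sqsumD.
by apply: ler_sqsum => i j; apply: ler_normD.
Qed.

Lemma summable2Z c t : summable2 t -> summable2 (fun i j => c * t i j).
Proof.
move=> [M tM]; exists (`|c| * M) => n.
apply: le_trans (ler_wpM2l (normr_ge0 c) (tM n)); rewrite -sqsumZ.
by apply: ler_sqsum => i j; rewrite normrM.
Qed.

Lemma cvgn_real_complex (v : nat -> R) (l : R) :
  v @ \oo --> l -> (fun n => (v n)%:C%C : C) @ \oo --> (l%:C%C : C).
Proof.
move=> vl; apply/cvgrPdist_lt => e e0.
have e_re : e = (complex.Re e)%:C%C by rewrite RRe_real // gtr0_real.
have e0' : 0 < complex.Re e by rewrite e_re ltcR in e0.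
have /cvgrPdist_lt/(_ _ e0') := vl; apply: filterS => n.
rewrite e_re -ltcR => le_n; apply: le_lt_trans le_n.
rewrite -rmorphB normc_def /= expr0n addr0 sqrtr_sqr.
by rewrite lexx.
Qed.

(** Nonnegative complex numbers are real, so monotone convergence in [R] applies to the real
    parts. *)
Lemma cvgn_bounded_incr (u : nat -> C) (M : C) :
  (forall n, 0 <= u n) -> (forall n, u n <= u n.+1) -> (forall n, u n <= M) ->
  cvgn u.
Proof.
move=> u0 u_incr uM.
pose v n := complex.Re (u n).
have uE : u = fun n => (v n)%:C%C.
  by apply/funext => n; rewrite RRe_real // ger0_real.
have v_cvg : cvgn v.
  apply: nondecreasing_is_cvgn.
    by apply/nondecreasing_seqP => n; have := u_incr n; rewrite lecE => /andP[].
  by exists (complex.Re M) => _ [n _ <-]; have := uM n; rewrite lecE => /andP[].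
by rewrite uE; apply: cvgP (cvgn_real_complex v_cvg).
Qed.

Lemma cvgn_sqsum_ge0 t : (forall i j, 0 <= t i j) -> summable2 t -> cvgn (sqsum t).
Proof.
move=> t0 [M tM]; apply: (@cvgn_bounded_incr _ M) => n.
- exact: sqsum_ge0.
- exact: sqsum_incr.
by apply: le_trans (tM n); apply: ler_sqsum => i j; rewrite ger0_norm.
Qed.

Lemma cvgn_abssum t : summable2 t -> cvgn (abssum t).
Proof. by move=> /summable2_norm st; apply: cvgn_sqsum_ge0. Qed.

Lemma cvgn_summable2 t : cvgn (abssum t) -> summable2 t.
Proof.
move=> /cvgrPdist_lt/(_ 1 ltr01)[N _ near_l].
set l := lim _ in near_l; exists (`|l| + 1) => n.
have := near_l (maxn n N) (leq_maxr n N) => lt_l.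
apply: (le_trans (@abssum_homo t _ _ (leq_maxl n N))).
rewrite -[leLHS]ger0_norm ?abssum_ge0 // -[abssum _ _](subKr l).
apply: le_trans (ler_normB _ _) _; rewrite lerD2l.
exact: ltW.
Qed.

(** Write t as (|t| + t) - |t|, a difference of nonnegative summable families. *)
Lemma cvgn_sqsum_real t : (forall i j, t i j \is Num.real) -> summable2 t ->
  cvgn (sqsum t).
Proof.
move=> t_real st.
have -> : sqsum t = (sqsum (fun i j => `|t i j| + t i j)) - abssum t.
  apply/funext => n; rewrite -[RHS]/(sqsum (fun i j => `|t i j| + t i j) n - abssum t n).
  by rewrite sqsumD /abssum addrAC subrr add0r.
apply: is_cvgB; last exact: cvgn_abssum.
apply: cvgn_sqsum_ge0; last by apply: summable2D => //; apply: summable2_norm.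
by move=> i j; rewrite -lerBlDr sub0r lerNl real_lerNnormlW.
Qed.

Lemma cvgn_sqsum t : summable2 t -> cvgn (sqsum t).
Proof.
move=> st.
have sJ : summable2 (fun i j => (t i j)^*).
  case: st => M tM; exists M => n; rewrite (_ : abssum _ n = abssum t n) //.
  by apply: sqsum_ext => i j; rewrite norm_conjC.
(* Conjugation splits [t] into two real families, twice the real part and -2 times the imaginary
   part. *)
have -> : sqsum t = (fun n => 2^-1 * sqsum (fun i j => t i j + (t i j)^*) n
    + (- 'i / 2) * sqsum (fun i j => 'i * (t i j + -1 * (t i j)^*)) n).
  apply/funext => n; rewrite -!sqsumZ -sqsumD; apply: sqsum_ext => i j.
  have := sqrCi C; set x := t i j; set y := x^*; set I := 'i => ii.
  rewrite (_ : - I / 2 * (I * (x + -1 * y)) = - (I ^+ 2) * (x - y) / 2); last by ring.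
  by rewrite ii; field.
apply: is_cvgD; apply: is_cvgMr; apply: cvgn_sqsum_real.
- by move=> i j; apply/CrealP; rewrite rmorphD /= conjCK addrC.
- exact: summable2D.
- move=> i j; apply/CrealP; rewrite rmorphM rmorphD rmorphM rmorphN1 /= conjCi conjCK; ring.
- by apply: summable2Z; apply: summable2D => //; apply: summable2Z.
Qed.

End DoubleSeries.

(** * Power series in two variables on closed polydiscs *)

Section PowerSeries.
Variable R : realType.
Local Notation C := (Cplx R).
Import numFieldNormedType.Exports.
Local Open Scope classical_set_scope.
Implicit Types (c d : nat -> nat -> C) (f g : C -> C -> C).

Lemma near_boxP (a : C * C) (P : C * C -> Prop) :
  (\forall x \near a, P x) <-> exists2 e : C, 0 < e &
    forall x, `|x.1 - a.1| <= e -> `|x.2 - a.2| <= e -> P x.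
Proof.
split=> [/nbhs_ballP[e /= e0 ball_P]|[e e0 box_P]].
  exists (e / 2) => [|x x1 x2]; first by rewrite divr_gt0.
  have lt_e : e / 2 < e by rewrite ltr_pdivrMr // mulr_natr mulr2n ltrDl.
  apply: ball_P; split; rewrite -ball_normE /= distrC.
    exact: le_lt_trans x1 lt_e.
  exact: le_lt_trans x2 lt_e.
apply/nbhs_ballP; exists e => //= x [].
rewrite -!ball_normE /= distrC => x1; rewrite distrC => x2.
by apply: box_P; apply: ltW.
Qed.

(** The order of C is partial; x y / (x + y) takes the place of a minimum. *)
Lemma pos_lower_bound (x y : C) : 0 < x -> 0 < y -> exists2 z, 0 < z & (z <= x) && (z <= y).
Proof.
move=> x0 y0; have xy0 : 0 < x + y by apply: addr_gt0.
exists (x * y / (x + y)); first by rewrite divr_gt0 // mulr_gt0.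
rewrite !ler_pdivrMr // !mulrDr lerDr [y * x]mulrC lerDl.
by rewrite !mulr_ge0 // ltW.
Qed.

Definition hterm c (s t : C) i j := c i j * s ^+ i * t ^+ j.

(** Summability at the corner (e, e) dominates the series on the whole polydisc of radius [e]. *)
Definition hser c (e : C) f := [/\ 0 < e, summable2 (hterm c e e) &
  forall s t, `|s| <= e -> `|t| <= e -> sqsum (hterm c s t) @ \oo --> f s t].

Lemma hterm_le c (e s t : C) : `|s| <= e -> `|t| <= e ->
  summable2 (hterm c e e) -> summable2 (hterm c s t).
Proof.
move=> se te /summable2_norm; apply: summable2_le => i j.
have e0 : 0 <= e by apply: le_trans se.
rewrite /hterm !normrM !normrX (ger0_norm e0) -!mulrA ler_wpM2l //.
by rewrite ler_pM ?exprn_ge0 // lerXn2r ?nnegrE.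
Qed.

Lemma hser_sub c (e e' : C) f : 0 < e' -> e' <= e -> hser c e f -> hser c e' f.
Proof.
move=> e'0 le_e [e0 sc cf]; split; first exact: e'0.
  by apply: hterm_le sc; rewrite gtr0_norm.
by move=> s t se te; apply: cf; apply: le_trans le_e.
Qed.

Lemma hser_exists c e : 0 < e -> summable2 (hterm c e e) -> exists f, hser c e f.
Proof.
move=> e0 sc; exists (fun s t => lim (sqsum (hterm c s t) @ \oo)).
split; [exact: e0|exact: sc|].
by move=> s t se te; apply: cvgn_sqsum; apply: hterm_le sc.
Qed.

Lemma hser_unique c e f g : hser c e f -> hser c e g ->
  forall s t, `|s| <= e -> `|t| <= e -> f s t = g s t.
Proof.
move=> [_ _ cf] [_ _ cg] s t se te.
exact: (norm_cvg_unique (cf s t se te) (cg s t se te)).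
Qed.

Lemma hser_ext c d e f g : (forall i j, c i j = d i j) ->
  (forall s t, f s t = g s t) -> hser c e f -> hser d e g.
Proof.
move=> cd fg; have -> : d = c by apply/funext => i; apply/funext => j.
by have -> : g = f by apply/funext => s; apply/funext => t.
Qed.

Lemma hserD c d e f g : hser c e f -> hser d e g ->
  hser (fun i j => c i j + d i j) e (fun s t => f s t + g s t).
Proof.
move=> [e0 sc cf] [_ sd dg].
have E s t : hterm (fun i j => c i j + d i j) s t
    = fun i j => hterm c s t i j + hterm d s t i j.
  by apply/funext => i; apply/funext => j; rewrite /hterm !mulrDl.
split; first exact: e0.
  by rewrite E; apply: summable2D.
move=> s t se te; rewrite E.
have -> : sqsum (fun i j => hterm c s t i j + hterm d s t i j)
    = (fun n => sqsum (hterm c s t) n + sqsum (hterm d s t) n).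
  by apply/funext => n; rewrite sqsumD.
by apply: cvgD; [apply: cf|apply: dg].
Qed.

Lemma hserZ z c e f : hser c e f ->
  hser (fun i j => z * c i j) e (fun s t => z * f s t).
Proof.
move=> [e0 sc cf].
have E s t : hterm (fun i j => z * c i j) s t = fun i j => z * hterm c s t i j.
  by apply/funext => i; apply/funext => j; rewrite /hterm !mulrA.
split; first exact: e0.
  by rewrite E; apply: summable2Z.
move=> s t se te; rewrite E.
have -> : sqsum (fun i j => z * hterm c s t i j) = (fun n => z * sqsum (hterm c s t) n).
  by apply/funext => n; rewrite sqsumZ.
by apply: cvgMr; apply: cf.
Qed.

Lemma sqsum_tr (t : nat -> nat -> C) n : sqsum (fun i j => t j i) n = sqsum t n.
Proof. exact: exchange_big. Qed.

Lemma hser_swap c e f : hser c e f -> hser (fun i j => c j i) e (fun s t => f t s).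
Proof.
move=> [e0 sc cf].
have E s t : hterm (fun i j => c j i) s t = fun i j => hterm c t s j i.
  by apply/funext => i; apply/funext => j; rewrite /hterm mulrAC.
split; first exact: e0.
  by rewrite E; case: sc => M sM; exists M => n; rewrite /abssum sqsum_tr; apply: sM.
move=> s t se te; rewrite E.
have -> : sqsum (fun i j => hterm c t s j i) = sqsum (hterm c t s).
  by apply/funext => n; rewrite sqsum_tr.
exact: cf.
Qed.

(** Multiplication by the first variable, on coefficients. *)
Definition shift (t : nat -> nat -> C) i j := if i is i'.+1 then t i' j else 0.

Lemma sqsum_shift t n :
  sqsum (shift t) n.+1 = sqsum t n + \sum_(i < n) t i n.
Proof.
rewrite /sqsum big_ord_recl /= big1 // add0r -big_split /=.
by apply: eq_bigr => i _; rewrite big_ord_recr.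
Qed.

Lemma summable2_shift t : summable2 t -> summable2 (shift t).
Proof.
move=> [M tM]; exists M => -[|n].
  by apply: le_trans (tM 0%N); rewrite /abssum /sqsum !big_ord0.
apply: le_trans (tM n.+1).
rewrite /abssum (@sqsum_ext _ _ (shift (fun i j => `|t i j|))).
  by rewrite sqsum_shift sqsumS lerDl sumr_ge0.
by case=> [|i] j //=; rewrite normr0.
Qed.

(** Shifting turns a square into a square plus an edge column. The edge is dominated by the
    increments of the convergent [abssum t], so it tends to 0. *)
Lemma cvg_sqsum_shift t (l : C) : summable2 t ->
  sqsum t @ \oo --> l -> sqsum (shift t) @ \oo --> l.
Proof.
move=> st tl; rewrite -(cvg_shiftS (sqsum (shift t))) -[l]addr0.
have -> : (fun n => sqsum (shift t) n.+1) = (fun n => sqsum t n + \sum_(i < n) t i n).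
  by apply/funext => n; rewrite sqsum_shift.
apply: cvgD; first exact: tl.
have abs_cvg := cvgn_abssum st; set L := lim _ in abs_cvg.
have : (fun n => abssum t n.+1 - abssum t n) @ \oo --> L - L.
  by apply: cvgB; [rewrite (cvg_shiftS (abssum t))|]; apply: abs_cvg.
rewrite subrr => /cvgrPdist_lt to0; apply/cvgrPdist_lt => e /to0.
apply: filterS => n; rewrite !sub0r !normrN; apply: le_lt_trans.
apply: le_trans (ler_norm_sum _ _ _) _.
rewrite ger0_norm ?subr_ge0 ?(@abssum_homo _ t) // /abssum sqsumS.
rewrite (_ : _ - _ = \sum_(i < n) `|t i n| + \sum_(j < n.+1) `|t n j|); last by ring.
by rewrite lerDl sumr_ge0.
Qed.

Lemma hser_mulX c e f : hser c e f -> hser (shift c) e (fun s t => s * f s t).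
Proof.
move=> [e0 sc cf].
have E s t : hterm (shift c) s t = fun i j => s * shift (hterm c s t) i j.
  apply/funext => -[|i]; apply/funext => j; rewrite /hterm /=.
    by rewrite !mul0r mulr0.
  by rewrite exprS; ring.
split; first exact: e0.
  by rewrite E; apply/summable2Z/summable2_shift.
move=> s t se te; rewrite E.
have -> : sqsum (fun i j => s * shift (hterm c s t) i j)
    = (fun n => s * sqsum (shift (hterm c s t)) n).
  by apply/funext => n; rewrite sqsumZ.
apply: cvgMr; apply: cvg_sqsum_shift; last exact: cf.
exact: hterm_le sc.
Qed.

Definition const_series (z : C) i j := if (i == 0)%N && (j == 0)%N then z else 0.

Lemma hser_const z e : 0 < e -> hser (const_series z) e (fun _ _ => z).
Proof.
move=> e0.
have sq0 w s t n : sqsum (hterm (const_series w) s t) n.+1 = w.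
  rewrite /sqsum big_ord_recl [X in _ + X]big1 ?addr0 => [|i _]; last first.
    by rewrite big1 // => j _; rewrite /hterm /= !mul0r.
  rewrite big_ord_recl [X in _ + X]big1 ?addr0 => [|j _]; last first.
    by rewrite /hterm /= !mul0r.
  by rewrite /hterm /= !mulr1.
split; first exact: e0.
  exists `|z| => -[|n]; first by rewrite /abssum /sqsum big_ord0.
  rewrite -(sq0 `|z| `|e| `|e| n); apply: ler_sqsum => i j.
  rewrite /hterm !normrM !normrX !ler_wpM2r ?exprn_ge0 //.
  by rewrite /const_series; case: ifP; rewrite ?normr0.
move=> s t _ _; rewrite -(cvg_shiftS (sqsum _)).
have -> : (fun n => sqsum (hterm (const_series z) s t) n.+1) = (fun=> z).
  by apply/funext => n; apply: sq0.
exact: cvg_cst.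
Qed.

End PowerSeries.

(** * Division of series by a unit and splitting off the constant term *)

Section Germs.
Variable R : realType.
Local Notation C := (Cplx R).
Import numFieldNormedType.Exports.
Local Open Scope classical_set_scope.
Implicit Types (c d : nat -> nat -> C) (f g : C -> C -> C).

(* Coefficients of c / (s - lam), from the recursion forced by (s - lam) d = c. *)
Fixpoint div_series (lam : C) c (i j : nat) : C :=
  if i is i'.+1 then (div_series lam c i' j - c i j) / lam else - c i j / lam.

Lemma div_seriesE lam c i j : lam != 0 ->
  shift (div_series lam c) i j + - lam * div_series lam c i j = c i j.
Proof. by move=> lam0; case: i => [|i] /=; field. Qed.

(** As e <= |lam| / 2, the recursion multiplies the previous term by at most 1/2 before adding a
    term of [c] over |lam|; summing over [i] for fixed [j] gives the geometric factor 2. *)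
Lemma div_series_summable lam c (e : C) : lam != 0 -> 0 < e -> e <= `|lam| / 2 ->
  summable2 (hterm c e e) -> summable2 (hterm (div_series lam c) e e).
Proof.
move=> lam0 e0 le_e [M cM]; exists (2 / `|lam| * M) => n.
have nlam0 : 0 < `|lam| by rewrite normr_gt0.
apply: le_trans (ler_wpM2l _ (cM n)); last by rewrite divr_ge0 // ltW.
pose D i j := `|hterm (div_series lam c) e e i j|; pose G i j := `|hterm c e e i j|.
have D0 j : D 0 j = G 0 j / `|lam|.
  by rewrite /D /G /hterm /= !normrM normrN normrV ?unitfE //; ring.
have DS i j : D i.+1 j <= D i j / 2 + G i.+1 j / `|lam|.
  rewrite /D /G; set d := div_series lam c.
  have -> : hterm d e e i.+1 j = hterm d e e i j * (e / lam) - hterm c e e i.+1 j / lam.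
    by rewrite /hterm /d [div_series _ _ i.+1 j]/= [e ^+ i.+1]exprS; ring.
  apply: le_trans (ler_normB _ _) _; rewrite !normrM !normrV ?unitfE //.
  rewrite lerD2r; apply: ler_wpM2l; first by rewrite !mulr_ge0.
  rewrite (gtr0_norm e0) ler_pdivrMr // mulrC.
  by rewrite (le_trans le_e).
have sumD j m : \sum_(i < m) D i j <= 2 / `|lam| * \sum_(i < m) G i j.
  elim: m => [|m IHm]; first by rewrite !big_ord0 mulr0.
  rewrite !big_ord_recl D0.
  have sumDS : \sum_(i < m) D i.+1 j <= \sum_(i < m) (D i j / 2 + G i.+1 j / `|lam|).
    by apply: ler_sum => i _; apply: DS.
  apply: le_trans (lerD (lexx _) sumDS) _.
  rewrite big_split /= -!mulr_suml.
  set S := \sum_(i < m) G i.+1 j; set T := \sum_(i < m) D i j in IHm *.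
  have T_le : T / 2 <= (G 0%N j + S) / `|lam|.
    rewrite ler_pdivrMr // (le_trans IHm) // -/G.
    have -> : (G 0%N j + S) / `|lam| * 2 = 2 / `|lam| * (G 0%N j + S) by ring.
    apply: ler_wpM2l; first by rewrite divr_ge0.
    have -> : G 0%N j + S = \sum_(i < m.+1) G i j by rewrite big_ord_recl.
    by rewrite big_ord_recr /= lerDl; apply: normr_ge0.
  have -> : 2 / `|lam| * (G 0%N j + S)
          = G 0%N j / `|lam| + ((G 0%N j + S) / `|lam| + S / `|lam|) by ring.
  by rewrite lerD2l lerD2r.
rewrite /abssum -[leLHS]sqsum_tr -[sqsum (fun i j => `|hterm c e e i j|) n]sqsum_tr.
rewrite /sqsum mulr_sumr.
by apply: ler_sum => j _; apply: sumD.
Qed.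

Lemma hser_div lam c e f : lam != 0 -> hser c e f ->
  exists d e' g, hser d e' g /\
    forall s t, `|s| <= e' -> `|t| <= e' -> f s t = (s - lam) * g s t.
Proof.
move=> lam0 cf; have [e0 _ _] := cf.
have lam_pos : 0 < `|lam| / 2 by rewrite divr_gt0 ?normr_gt0.
have [e' e'0 /andP[le_e le_lam]] := pos_lower_bound e0 lam_pos.
have cf' := hser_sub e'0 le_e cf; have [_ sc _] := cf'.
have [g dg] := hser_exists e'0 (div_series_summable lam0 e'0 le_lam sc).
exists (div_series lam c), e', g; split; first exact: dg.
have cg : hser c e' (fun s t => (s - lam) * g s t).
  apply: hser_ext (hserD (hser_mulX dg) (hserZ (- lam) dg)) => [i j|s t].
    exact: div_seriesE.
  by rewrite /= mulrBl mulNr.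
by move=> s t; apply: (hser_unique cf' cg).
Qed.

(** Separate the terms divisible by s from those with i = 0; dividing by s costs a factor 1/e in the
    bound. *)
Lemma hser_split c e f : hser c e f -> exists c1 f1 g,
  [/\ hser c1 e f1, hser (fun i j => if i is 0 then c 0 j else 0) e g &
    forall s t, `|s| <= e -> `|t| <= e -> f s t = s * f1 s t + g s t].
Proof.
move=> cf; have [e0 sc _] := cf.
pose c1 i j := c i.+1 j; pose c0 i j := if i is 0 then c 0%N j else 0.
have s0 : summable2 (hterm c0 e e).
  apply: summable2_le (summable2_norm sc) => -[|i] j //.
  by rewrite /hterm /= !mul0r normr0.
have s1 : summable2 (hterm c1 e e).
  have [M cM] := sc; exists (e^-1 * M) => n.
  apply: le_trans (ler_wpM2l _ (cM n.+1)); last by rewrite invr_ge0 ltW.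
  rewrite /abssum (@sqsum_ext _ _ (fun i j => e^-1 * `|hterm c e e i.+1 j|)); last first.
    move=> i j; rewrite -[e^-1]gtr0_norm ?invr_gt0 // -normrM; congr `|_|.
    by rewrite /hterm exprS /c1; field; rewrite gt_eqF.
  rewrite sqsumZ; apply: ler_wpM2l; first by rewrite invr_ge0 ltW.
  rewrite /sqsum [leRHS]big_ord_recl.
  rewrite -[leLHS]add0r; apply: lerD; first by apply: sumr_ge0.
  by apply: ler_sum => i _; rewrite big_ord_recr /= lerDl.
have [f1 cf1] := hser_exists e0 s1; have [g c0g] := hser_exists e0 s0.
have cg : hser c e (fun s t => s * f1 s t + g s t).
  apply: hser_ext (hserD (hser_mulX cf1) c0g) => [[|i] j|s t] //=.
    exact: add0r.
  exact: addr0.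
exists c1, f1, g; split; [exact: cf1|exact: c0g|].
by move=> s t; apply: (hser_unique cf cg).
Qed.

Lemma hser_decomp c e f : hser c e f -> exists z c1 c2 f1 f2,
  [/\ hser c1 e f1, hser c2 e f2 & forall s t, `|s| <= e -> `|t| <= e ->
    f s t = z + s * f1 s t + t * f2 s t].
Proof.
move=> cf; have [e0 _ _] := cf.
have [c1 [f1 [g [cf1 cg fE]]]] := hser_split cf.
have [c2 [f2 [h [cf2 ch gE]]]] := hser_split (hser_swap cg).
exists (c 0%N 0%N), c1, (fun i j => c2 j i), f1, (fun s t => f2 t s).
split; [exact: cf1|exact: hser_swap cf2|move=> s t se te].
have hz : hser (const_series (c 0%N 0%N)) e h.
  by apply: hser_ext ch => [[|i] [|j]|].
have hE : h t s = c 0%N 0%N by apply: (hser_unique hz (hser_const _ e0)).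
by rewrite fE // (gE t s) // hE addrA addrC addrA.
Qed.

End Germs.

(** * Zeros of a polynomial in two variables are not isolated *)

Section ZerosNotIsolated.
Variable C : numClosedFieldType.
Implicit Types (p q : {poly C}) (H : {poly {poly C}}).

Lemma horner_lipschitz p (a : C) : exists2 K, 0 <= K &
  forall s, `|s| <= 1 -> `|p.[a + s] - p.[a]| <= K * `|s|.
Proof.
elim/poly_ind: p => [|p c [K K0 pK]].
  by exists 0 => // s _; rewrite !horner0 subrr normr0 mul0r.
exists (K * (`|a| + 1) + `|p.[a]|) => [|s s1].
  by rewrite addr_ge0 // mulr_ge0 // addr_ge0.
rewrite !hornerMXaddC.
have -> : p.[a + s] * (a + s) + c - (p.[a] * a + c)
        = (p.[a + s] - p.[a]) * (a + s) + p.[a] * s by ring.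
apply: le_trans (ler_normD _ _) _; rewrite !normrM mulrDl lerD2r mulrAC.
apply: ler_pM => //; first exact: pK.
by apply: le_trans (ler_normD _ _) _; rewrite lerD2l.
Qed.

(** Split off the roots one by one: a factor X - z with |z| >= e multiplies the left side by at most
    |z| + e and the constant term by |z|, so each root costs at most a factor 2. *)
Lemma coef_le_coef0 q (e : C) k : 0 <= e -> (forall z, root q z -> e <= `|z|) ->
  `|q`_k| * e ^+ k <= 2 ^+ size q * `|q`_0|.
Proof.
move=> e0; have [n] := ubnP (size q); elim: n => // n IHn in q k *.
rewrite ltnS => le_n root_q.
have [sz1|sz1] := leqP (size q) 1.
  have [c ->] : exists c, q = c%:P by exists q`_0; apply: size1_polyC.
  rewrite !coefC eqxx; case: k => [|k] /=.
    by rewrite expr0 mulr1 ler_peMl // exprn_ege1 // ler1n.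
  by rewrite normr0 mul0r mulr_ge0 // exprn_ge0.
have [z qz] := closed_rootP q (negbT (gtn_eqF sz1)).
have := qz; rewrite -dvdp_XsubCl => /dvdpP[q' def_q].
have q0 : q != 0 by apply: contraTneq sz1 => ->; rewrite size_poly0.
have q'0 : q' != 0 by apply: contraNneq q0 => q'0; rewrite def_q q'0 mul0r.
have sz_q : size q = (size q').+1.
  by rewrite def_q size_Mmonic ?monicXsubC // size_XsubC addn2.
have root_q' y : root q' y -> e <= `|y|.
  by move=> q'y; apply: root_q; rewrite def_q rootM q'y.
have le_q' i : `|q'`_i| * e ^+ i <= 2 ^+ size q' * `|q'`_0|.
  by apply: IHn root_q'; rewrite -ltnS -sz_q.
have def_qk i : q`_i = (if i is i'.+1 then q'`_i' else 0) - z * q'`_i.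
  by rewrite def_q mulrBr coefB coefMX coefMC [z * _]mulrC; case: i.
rewrite sz_q !def_qk sub0r normrN normrM exprS.
have e_le : e <= `|z| := root_q z qz.
have rhsE : 2 * 2 ^+ size q' * (`|z| * `|q'`_0|)
    = `|z| * (2 ^+ size q' * `|q'`_0|) + `|z| * (2 ^+ size q' * `|q'`_0|) by ring.
rewrite rhsE; case: k => [|k].
  rewrite sub0r normrN normrM -mulrA ler_wpDl ?ler_wpM2l //.
  by rewrite !mulr_ge0 // exprn_ge0.
apply: le_trans (ler_wpM2r _ (ler_normB _ _)) _; first by rewrite exprn_ge0.
rewrite mulrDl; apply: lerD; last by rewrite normrM -mulrA ler_wpM2l.
rewrite exprS mulrCA; apply: ler_pM => //.
by rewrite mulr_ge0 // exprn_ge0.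
Qed.

Lemma ev_spec H (x : C * C) : ev H x = (spec x.1 H).[x.2].
Proof.
rewrite /ev /spec -[x.2 in RHS](hornerC x.2 x.1).
by rewrite -[(x.2%:P).[x.1] in RHS]/(horner_eval x.1 x.2%:P) horner_map.
Qed.

(** Continuity of roots, made quantitative. If on the nearby lines x = a.1 + s all roots stay at
    distance at least [e] from a.2, the previous bound compares a coefficient that is nonzero at s =
    0 with the constant one, which vanishes there. *)
Lemma zeros_not_isolated H (a : C * C) (e : C) : 0 < e -> ev H a = 0 ->
  exists b : C * C, [/\ b != a, `|b.1 - a.1| <= e, `|b.2 - a.2| <= e & ev H b = 0].
Proof.
move=> e0 Ha.
have [Ha0|Ha_neq0] := eqVneq (spec a.1 H) 0.
  exists (a.1, a.2 + e); rewrite /= subrr addrAC subrr add0r normr0 gtr0_norm //.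
  split=> //; last by rewrite ev_spec /= Ha0 horner0.
  - apply/eqP => /(congr1 snd)/= /eqP.
    by rewrite -[eqbRHS]addr0 (inj_eq (addrI _)) gt_eqF.
  - exact: ltW.
apply: contrapT => no_zero.
pose A : {poly {poly C}} := H \Po ('X + a.2%:P%:P).
pose G s : {poly C} := spec (a.1 + s) A.
have evG s t : (G s).[t] = ev H (a.1 + s, a.2 + t).
  rewrite -(ev_spec A (a.1 + s, t)) /ev /A /= horner_comp !hornerE /=.
  by rewrite -polyCD addrC.
have GE s i : (G s)`_i = (A`_i).[a.1 + s] by rewrite coef_map.
have [k Ak] : exists k, (A`_k).[a.1] != 0.
  apply: contrapT => /forallNP A0; case/eqP: Ha_neq0.
  have G0 : G 0 = 0.
    by apply/polyP => i; rewrite GE addr0 coef0; apply/eqP/negPn/negP/A0.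
  apply/polyP => i; rewrite coef0.
  have -> : spec a.1 H = G 0 \Po ('X - a.2%:P).
    rewrite /G addr0 /A /spec map_comp_poly -comp_polyA.
    rewrite rmorphD /= map_polyX map_polyC /= /horner_eval hornerC.
    by rewrite comp_polyD comp_polyX comp_polyC subrK comp_polyXr.
  by rewrite G0 comp_poly0 coef0.
have A0a : (A`_0).[a.1] = 0.
  by rewrite -[a.1]addr0 -GE -horner_coef0 evG !addr0 -surjective_pairing.
have [K0 K0_ge0 lip0] := horner_lipschitz A`_0 a.1.
have [K1 K1_ge0 lip1] := horner_lipschitz A`_k a.1.
pose D := size A.
pose B := `|(A`_k).[a.1]| * e ^+ k.
pose K := 2 ^+ D * K0 + K1 * e ^+ k.
have B0 : 0 < B by rewrite mulr_gt0 ?normr_gt0 // exprn_gt0.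
have K_ge0 : 0 <= K by rewrite addr_ge0 // mulr_ge0 // exprn_ge0 // ltW.
(* Coefficients [k] and 0 are both Lipschitz in s, while [B] is positive and independent of s. *)
have small s : 0 < s -> s <= 1 -> s <= e -> B <= K * s.
  move=> s0 s1 se; have ns : `|s| = s by rewrite gtr0_norm.
  have root_G z : root (G s) z -> e <= `|z|.
    move=> /rootP Gz; rewrite real_leNgt ?realE ?normr_ge0 ?(ltW e0) //; apply/negP => lt_z.
    apply: no_zero; exists (a.1 + s, a.2 + z); rewrite /= ![_ + _ - _]addrAC !subrr !add0r.
    split; rewrite ?ns -?evG //; last exact: ltW.
    apply/eqP => /(congr1 fst)/= /eqP.
    by rewrite -[eqbRHS]addr0 (inj_eq (addrI _)) gt_eqF.
  have le_k := coef_le_coef0 k (ltW e0) root_G; rewrite !GE in le_k.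
  have sz_G : (size (G s) <= D)%N by apply: size_poly.
  have lip0s := lip0 s; have lip1s := lip1 s; rewrite ns in lip0s lip1s.
  have {lip0s} := lip0s s1; rewrite A0a subr0 => lip0s.
  rewrite /B /K mulrDl.
  have e_k : 0 <= e ^+ k by rewrite exprn_ge0 // ltW.
  have : `|(A`_k).[a.1]| <= `|(A`_k).[a.1 + s]| + K1 * s.
    rewrite -lerBlDl; apply: le_trans (lip1s s1); rewrite distrC.
    exact: lerB_dist.
  move/(ler_wpM2r e_k); rewrite mulrDl mulrAC => /le_trans; apply.
  rewrite lerD2r (le_trans le_k) // -mulrA.
  apply: ler_pM => //; first by rewrite exprn_ge0.
  by rewrite ler_weXn2l // ler1n.
have [d d0 /andP[d1 de]] : exists2 d : C, 0 < d & (d <= 1) && (d <= e).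
  exists (e / (1 + e)); first by rewrite divr_gt0 // addr_gt0.
  by rewrite !ler_pdivrMr ?addr_gt0 // mul1r mulrDr mulr1 lerDr lerDl mulr_ge0 ?ltW.
have KB0 : 0 < K + B by rewrite ltr_wpDl.
(* This choice gives [K * s < B], since [d <= 1]. *)
pose s := d * (B / (K + B)).
have r1 : B / (K + B) <= 1 by rewrite ler_pdivrMr // mul1r lerDr.
have s0 : 0 < s by rewrite mulr_gt0 // divr_gt0.
have s_le : s <= d by rewrite ler_piMr // ltW.
have := small s s0 (le_trans s_le d1) (le_trans s_le de).
rewrite /s mulrA [K * d * _]mulrA ler_pdivlMr // [K * d * B]mulrC ler_pM2l //.
rewrite lt_geF //; apply: (le_lt_trans (y := K)).
  by rewrite ler_piMr.
by rewrite ltrDl.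
Qed.

End ZerosNotIsolated.

(** * Germs of holomorphic functions *)

Section LocalAlgebra.
Variable R : realType.
Local Notation C := (Cplx R).
Import numFieldNormedType.Exports.
Local Open Scope classical_set_scope.
Local Notation R2 := {poly {poly C}}.
Implicit Types (a : C * C) (f g h : C * C -> C).

Lemma near_all a (P : C * C -> Prop) : (forall x, P x) -> \forall x \near a, P x.
Proof. exact: filterE. Qed.

Lemma near_and a (P Q S : C * C -> Prop) : (forall x, P x -> Q x -> S x) ->
  (\forall x \near a, P x) -> (\forall x \near a, Q x) -> \forall x \near a, S x.
Proof. exact: filterS2. Qed.

Lemma near_imp a (P Q : C * C -> Prop) : (forall x, P x -> Q x) ->
  (\forall x \near a, P x) -> \forall x \near a, Q x.
Proof. exact: filterS. Qed.

Definition translate a f : C -> C -> C := fun s t => f (a.1 + s, a.2 + t).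

Lemma translate_sub a f x : translate a f (x.1 - a.1) (x.2 - a.2) = f x.
Proof.
by rewrite /translate ![_ + (_ - _)]addrC !subrK -surjective_pairing.
Qed.

Lemma holo_atP a f : holo_at a f <-> exists c e, hser c e (translate a f).
Proof.
split=> [[c /near_boxP[e e0 cf]]|[c [e [e0 sc cf]]]]; exists c.
  have boxE s t : `|s| <= e -> `|t| <= e ->
      cvgn (abssum (hterm c s t)) /\ sqsum (hterm c s t) @ \oo --> translate a f s t.
    move=> se te; have := cf (a.1 + s, a.2 + t).
    have -> : (a.1 + s, a.2 + t).1 - a.1 = s by rewrite /= addrAC subrr add0r.
    have -> : (a.1 + s, a.2 + t).2 - a.2 = t by rewrite /= addrAC subrr add0r.
    by apply.
  exists e; split; first exact: e0.
    have e_e : `|e| <= e by rewrite gtr0_norm.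
    by have [/cvgn_summable2] := boxE e e e_e e_e.
  by move=> s t se te; have [] := boxE s t se te.
apply/near_boxP; exists e => // x x1 x2; split.
  by apply: (cvgn_abssum (t := hterm c _ _)); apply: hterm_le sc.
by have := cf _ _ x1 x2; rewrite translate_sub.
Qed.

Lemma holo_of_hser a c e (F : C -> C -> C) :
  hser c e F -> holo_at a (fun x => F (x.1 - a.1) (x.2 - a.2)).
Proof.
move=> cF; apply/holo_atP; exists c, e; apply: hser_ext cF => // s t.
by rewrite /translate /= ![_ + _ - _]addrAC !subrr !add0r.
Qed.

Lemma holo_near a f g : holo_at a f -> (\forall x \near a, f x = g x) -> holo_at a g.
Proof.
move=> /holo_atP[c [e cf]] /near_boxP[e' e'0 fg]; apply/holo_atP.
have [e0 _ _] := cf; have [d d0 /andP[de de']] := pos_lower_bound e0 e'0.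
exists c, d; have [_ sc cfd] := hser_sub d0 de cf; split; [exact: d0|exact: sc|].
move=> s t sd td; have <- : translate a f s t = translate a g s t.
  by apply: fg; rewrite /= addrAC subrr add0r (le_trans _ de').
exact: cfd.
Qed.

Lemma holo_const a z : holo_at a (fun=> z).
Proof.
apply/holo_atP; exists (const_series z), 1; apply: (hser_const z ltr01).
Qed.

Lemma holoD a f g : holo_at a f -> holo_at a g -> holo_at a (fun x => f x + g x).
Proof.
move=> /holo_atP[c [e cf]] /holo_atP[d [e' dg]]; apply/holo_atP.
have [e0 _ _] := cf; have [e'0 _ _] := dg.
have [r r0 /andP[re re']] := pos_lower_bound e0 e'0.
exists (fun i j => c i j + d i j), r.
exact: (hserD (hser_sub r0 re cf) (hser_sub r0 re' dg)).
Qed.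

Lemma holoZ a z f : holo_at a f -> holo_at a (fun x => z * f x).
Proof.
move=> /holo_atP[c [e cf]]; apply/holo_atP.
by exists (fun i j => z * c i j), e; apply: (hserZ z cf).
Qed.

Lemma holo_sum a (I : finType) (F : I -> C * C -> C) :
  (forall i, holo_at a (F i)) -> holo_at a (fun x => \sum_i F i x).
Proof.
move=> hF; elim: (index_enum I) => [|i s IHs].
  by apply: (holo_near (holo_const a 0)); apply: near_all => x; rewrite big_nil.
by apply: (holo_near (holoD (hF i) IHs)); apply: near_all => x; rewrite big_cons.
Qed.

Definition swap_pt (x : C * C) : C * C := (x.2, x.1).

Lemma near_swap a (P : C * C -> Prop) :
  (\forall x \near a, P x) -> \forall x \near swap_pt a, P (swap_pt x).
Proof.
by move=> /near_boxP[e e0 PP]; apply/near_boxP; exists e => // x x1 x2; apply: PP.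
Qed.

Lemma holo_swap a f : holo_at a f -> holo_at (swap_pt a) (f \o swap_pt).
Proof.
move=> /holo_atP[c [e cf]]; apply/holo_atP; exists (fun i j => c j i), e.
exact: (hser_swap cf).
Qed.

(* The two coordinate functions centred at a enter the argument only through
   these closure properties. *)
Definition coordinate_at a (l : C * C -> C) := [/\ l a = 0,
  forall f, holo_at a f -> holo_at a (fun x => l x * f x),
  (forall lam : C, lam != 0 -> \forall x \near a, l x - lam != 0) &
  forall (lam : C) f, lam != 0 -> holo_at a f ->
    exists2 g, holo_at a g & \forall x \near a, f x = (l x - lam) * g x].

Lemma coordinate1 a : coordinate_at a (fun x => x.1 - a.1).
Proof.
split=> [|f|lam lam0|lam f lam0]; first exact: subrr.
- move=> /holo_atP[c [e cf]]; apply/holo_atP; exists (shift c), e.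
  apply: hser_ext (hser_mulX cf) => // s t.
  by rewrite /translate /= addrAC subrr add0r.
- apply/near_boxP; exists (`|lam| / 2) => [|x x1 _]; first by rewrite divr_gt0 ?normr_gt0.
  rewrite subr_eq0; apply: contraTneq x1 => ->; rewrite lt_geF //.
  by rewrite ltr_pdivrMr // mulr_natr mulr2n ltrDl normr_gt0.
move=> /holo_atP[c [e cf]]; have [d [e' [G [dG fG]]]] := hser_div lam0 cf.
exists (fun x => G (x.1 - a.1) (x.2 - a.2)); first exact: holo_of_hser dG.
apply/near_boxP; have [e'0 _ _] := dG; exists e' => // x x1 x2.
by rewrite -fG // translate_sub.
Qed.

Lemma coordinate2 a : coordinate_at a (fun x => x.2 - a.2).
Proof.
case: a => a1 a2; have [_ mulX nearX divX] := coordinate1 (a2, a1).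
have swapK f x : (f \o swap_pt) (swap_pt x) = f x by case: x.
split=> [|f|lam lam0|lam f lam0]; first exact: subrr.
- move=> /holo_swap/mulX/holo_swap hf; apply: (holo_near hf).
  by apply: near_all => x; rewrite /= -(swapK f x).
- exact: (near_swap (nearX lam lam0)).
move=> /holo_swap/(divX _ _ lam0)[g /holo_swap hg /near_swap fg].
exists (g \o swap_pt) => //; apply: near_imp fg => x.
by rewrite swapK.
Qed.

Lemma holo_decomp a f : holo_at a f -> exists z f1 f2,
  [/\ holo_at a f1, holo_at a f2 &
    \forall x \near a, f x = z + (x.1 - a.1) * f1 x + (x.2 - a.2) * f2 x].
Proof.
move=> /holo_atP[c [e cf]]; have [z [c1 [c2 [F1 [F2 [cF1 cF2 fE]]]]]] := hser_decomp cf.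
exists z, (fun x => F1 (x.1 - a.1) (x.2 - a.2)), (fun x => F2 (x.1 - a.1) (x.2 - a.2)).
split; [exact: holo_of_hser cF1|exact: holo_of_hser cF2|].
apply/near_boxP; have [e0 _ _] := cF1; exists e => // x x1 x2.
by rewrite -fE // translate_sub.
Qed.

(** Horner induction in y and then in x reduces to the coordinate functions. *)
Lemma holo_mul_ev a (p : R2) f : holo_at a f -> holo_at a (fun x => ev p x * f x).
Proof.
move=> hf; have mul_coord l (c : C) g : coordinate_at a (fun x => l x - c) ->
    holo_at a g -> holo_at a (fun x => l x * g x).
  move=> [_ mul_l _ _] hg; apply: (holo_near (holoD (mul_l _ hg) (holoZ c hg))).
  by apply: near_all => x; rewrite -mulrDl subrK.
have hx (q : {poly C}) : holo_at a (fun x => q.[x.1] * f x).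
  elim/poly_ind: q => [|q c IHq].
    by apply: (holo_near (holo_const a 0)); apply: near_all => x; rewrite horner0 mul0r.
  apply: (holo_near (holoD (mul_coord _ _ _ (coordinate1 a) IHq) (holoZ c hf))).
  by apply: near_all => x; rewrite hornerMXaddC; ring.
elim/poly_ind: p => [|p q IHp].
  by apply: (holo_near (holo_const a 0)); apply: near_all => x; rewrite /ev !horner0 mul0r.
apply: (holo_near (holoD (mul_coord _ _ _ (coordinate2 a) IHp) (hx q))).
by apply: near_all => x; rewrite /ev hornerMXaddC hornerD hornerM hornerC; ring.
Qed.

Lemma holo_ev a (p : R2) : holo_at a (ev p).
Proof.
apply: (holo_near (holo_mul_ev p (holo_const a 1))).
by apply: near_all => x; rewrite mulr1.
Qed.

End LocalAlgebra.

(** * Ideals of finite codimension in O_a *)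

Section GermIdeals.
Variable R : realType.
Local Notation C := (Cplx R).
Import numFieldNormedType.Exports.
Local Open Scope classical_set_scope.
Local Notation R2 := {poly {poly C}}.
Variables (a : C * C) (P Q : C * C -> C).
Implicit Types (f g h : C * C -> C).
Local Notation I := (germ_ideal2 a P Q).

Lemma gi_near f g : I f -> (\forall x \near a, f x = g x) -> I g.
Proof.
move=> [u [v [hu hv fE]]] fg; exists u, v; split=> //.
by apply: (near_and _ fE fg) => x <- <-.
Qed.

Lemma gi_eq f g : I f -> (forall x, f x = g x) -> I g.
Proof. by move=> If fg; apply: (gi_near If); apply: near_all. Qed.

Lemma gi0 : I (fun=> 0).
Proof.
exists (fun=> 0), (fun=> 0); split; [exact: holo_const|exact: holo_const|].
by apply: near_all => x; rewrite !mul0r addr0.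
Qed.

Lemma giD f g : I f -> I g -> I (fun x => f x + g x).
Proof.
move=> [u [v [hu hv fE]]] [u' [v' [hu' hv' gE]]].
exists (fun x => u x + u' x), (fun x => v x + v' x).
split; [exact: holoD|exact: holoD|].
by apply: (near_and _ fE gE) => x -> ->; ring.
Qed.

Lemma gi_mul l f : (forall h, holo_at a h -> holo_at a (fun x => l x * h x)) ->
  I f -> I (fun x => l x * f x).
Proof.
move=> hl [u [v [hu hv fE]]]; exists (fun x => l x * u x), (fun x => l x * v x).
split; [exact: hl|exact: hl|].
by apply: near_imp fE => x ->; ring.
Qed.

Lemma gi_mul_ev (p : R2) f : I f -> I (fun x => ev p x * f x).
Proof. by apply: gi_mul => h; apply: holo_mul_ev. Qed.

Lemma giZ z f : I f -> I (fun x => z * f x).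
Proof. by apply: gi_mul => h; apply: holoZ. Qed.

Lemma gi_sum (J : finType) (F : J -> C * C -> C) :
  (forall j, I (F j)) -> I (fun x => \sum_j F j x).
Proof.
move=> IF; elim: (index_enum J) => [|j s IHs].
  by apply: (gi_eq gi0) => x; rewrite big_nil.
by apply: (gi_eq (giD (IF j) IHs)) => x; rewrite big_cons.
Qed.

Lemma gi_div l lam f : coordinate_at a l -> lam != 0 ->
  I (fun x => (l x - lam) * f x) -> I f.
Proof.
move=> [_ _ near_l div_l] lam0 [u [v [hu hv fE]]].
have [u' hu' uE] := div_l lam u lam0 hu; have [v' hv' vE] := div_l lam v lam0 hv.
exists u', v'; split=> //.
have uvE := near_and (fun x (A : u x = _) (B : v x = _) => conj A B) uE vE.
apply: (near_and _ (near_and (fun x A B => conj A B) fE uvE) (near_l lam lam0)).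
move=> x [fEx [uEx vEx]] lx; apply: (mulfI lx).
by rewrite fEx uEx vEx; ring.
Qed.

Variable n : nat.
Hypothesis codim_n : germ_codim a I n.

(* The n + 1 germs h, l h, ..., l^n h are dependent modulo I, so s(l) h lies in
   I for some nonzero polynomial s of degree at most n; the factors l - lam of
   s(l) with lam nonzero are units. *)
Lemma gi_nilpotent l h : coordinate_at a l -> holo_at a h ->
  I (fun x => l x ^+ n * h x).
Proof.
move=> coord_l hh; have [_ mul_l _ _] := coord_l.
have [e [he basis]] := codim_n.
have hF k : holo_at a (fun x => l x ^+ k * h x).
  elim: k => [|k IHk].
    by apply: (holo_near hh); apply: near_all => x; rewrite expr0 mul1r.
  apply: (holo_near (mul_l _ IHk)); apply: near_all => x.
  by rewrite exprS mulrA.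
have /choice[c Ic] (k : 'I_n.+1) : exists c : 'rV[C]_n,
    I (fun x => l x ^+ k * h x - \sum_i c ord0 i * e i x).
  by have [c [Ic _]] := basis _ (hF k); exists c.
(* The rows are the coordinates modulo I of the germs l^k h; a vector in the left kernel provides
   the coefficients of [s]. *)
pose M : 'M[C]_(n.+1, n) := \matrix_(k, i) c k ord0 i.
have : kermx M != 0.
  rewrite -mxrank_eq0 mxrank_ker subn_eq0 -ltnNge ltnS.
  exact: rank_leq_col.
move=> /rowV0Pn[v /sub_kermxP vM v0].
pose s : {poly C} := \poly_(k < n.+1) (if insub k is Some k' then v ord0 k' else 0).
have s_coef (k : 'I_n.+1) : s`_k = v ord0 k.
  by rewrite coef_poly ltn_ord valK.
have s0 : s != 0.
  apply: contraNneq v0 => s0; apply/eqP/rowP => k.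
  by rewrite -s_coef s0 coef0 mxE.
have Is : I (fun x => s.[l x] * h x).
  apply: (gi_eq (gi_sum (fun k => giZ (v ord0 k) (Ic k)))) => x.
  rewrite (horner_coef_wide _ (size_poly _ _)) mulr_suml.
  under eq_bigr do rewrite mulrBr.
  rewrite sumrB [X in _ - X](_ : _ = 0) ?subr0.
    by apply: eq_bigr => k _; rewrite s_coef mulrA.
  under eq_bigr do rewrite mulr_sumr.
  rewrite exchange_big big1 // => i _.
  have := congr1 (fun A : 'rV[C]_n => A ord0 i) vM; rewrite !mxE => vMi.
  transitivity ((\sum_k v ord0 k * M k i) * e i x); last by rewrite vMi mul0r.
  by rewrite mulr_suml; apply: eq_bigr => k _; rewrite mxE mulrA.
(* Induction on the degree bound: a root 0 of [r] goes into the power of [l], a nonzero root is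
   cancelled as a unit, and a nonzero constant remains. *)
have reduce m (r : {poly C}) k : r != 0 -> (size r <= m.+1)%N ->
    I (fun x => r.[l x] * (l x ^+ k * h x)) -> I (fun x => l x ^+ (k + m) * h x).
  elim: m r k => [|m IHm] r k r0 sz_r Ir.
    have rE := size1_polyC sz_r; rewrite addn0.
    have c0 : r`_0 != 0 by apply: contraNneq r0 => c0; rewrite rE c0.
    apply: (gi_eq (giZ (r`_0)^-1 Ir)) => x.
    by rewrite rE hornerC coefC eqxx mulKf.
  have [sz1|sz1] := leqP (size r) 1.
    apply: (gi_eq (gi_mul (l := l) mul_l (IHm r k r0 (leq_trans sz1 _) Ir))) => // x.
    by rewrite addnS exprS mulrA.
  have [z rz] := closed_rootP r (negbT (gtn_eqF sz1)).
  have := rz; rewrite -dvdp_XsubCl => /dvdpP[r' def_r].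
  have r'0 : r' != 0 by apply: contraNneq r0 => r'0; rewrite def_r r'0 mul0r.
  have sz_r' : (size r' <= m.+1)%N.
    by rewrite -ltnS; move: sz_r; rewrite def_r size_Mmonic ?monicXsubC // size_XsubC addn2.
  have [z0|z0] := eqVneq z 0.
    rewrite -addSnnS; apply: (IHm r') => //; apply: (gi_eq Ir) => x.
    by rewrite def_r z0 hornerM hornerXsubC subr0 exprS; ring.
  have Ir' : I (fun x => r'.[l x] * (l x ^+ k * h x)).
    apply: (gi_div coord_l z0); apply: (gi_eq Ir) => x.
    by rewrite def_r hornerM hornerXsubC; ring.
  apply: (gi_eq (gi_mul (l := l) mul_l (IHm r' k r'0 sz_r' Ir'))) => x.
  by rewrite addnS exprS mulrA.
have Is0 : I (fun x => s.[l x] * (l x ^+ 0 * h x)).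
  by apply: (gi_eq Is) => x; rewrite expr0 mul1r.
exact: (reduce n s 0%N s0 (size_poly _ _) Is0).
Qed.

(** One of the exponents is at least [n], and the n-th power of either coordinate maps O_a into
    I. *)
Lemma gi_monomial i j h : (n.*2 <= i + j)%N -> holo_at a h ->
  I (fun x => (x.1 - a.1) ^+ i * (x.2 - a.2) ^+ j * h x).
Proof.
move=> le_ij hh; have coord1 := coordinate1 a; have coord2 := coordinate2 a.
have [_ mul1 _ _] := coord1; have [_ mul2 _ _] := coord2.
have hpow (l : C * C -> C) k g :
    (forall f, holo_at a f -> holo_at a (fun x => l x * f x)) ->
    holo_at a g -> holo_at a (fun x => l x ^+ k * g x).
  move=> mul_l hg; elim: k => [|k IHk].
    by apply: (holo_near hg); apply: near_all => x; rewrite expr0 mul1r.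
  by apply: (holo_near (mul_l _ IHk)); apply: near_all => x; rewrite exprS mulrA.
have [le_i|lt_i] := leqP n i.
  have hg := hpow _ (i - n)%N _ mul1 (hpow _ j _ mul2 hh).
  apply: (gi_eq (gi_nilpotent coord1 hg)) => x.
  by rewrite mulrA -exprD subnKC // mulrA.
have le_j : (n <= j)%N by clear - le_ij lt_i; lia.
have hg := hpow _ (j - n)%N _ mul2 (hpow _ i _ mul1 hh).
apply: (gi_eq (gi_nilpotent coord2 hg)) => x.
by rewrite mulrA -exprD subnKC // mulrA [in RHS](mulrC (_ ^+ i)).
Qed.

(** Taylor expansion: constant terms are split off until the remainders carry monomials of degree
    2n, which lie in I. *)
Lemma gi_poly h : holo_at a h -> exists p : R2, I (fun x => h x - ev p x).
Proof.
move=> hh; suff dense m i j g : (i + j + m)%N = n.*2 -> holo_at a g ->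
    exists p : R2, I (fun x => (x.1 - a.1) ^+ i * (x.2 - a.2) ^+ j * g x - ev p x).
  have [p Ip] := dense n.*2 0%N 0%N h (add0n _) hh.
  by exists p; apply: (gi_eq Ip) => x; rewrite !expr0 !mul1r.
elim: m i j g => [|m IHm] i j g eq_n hg.
  exists 0; have le_n : (n.*2 <= i + j)%N by rewrite -eq_n addn0.
  by apply: (gi_eq (gi_monomial le_n hg)) => x; rewrite /ev !horner0 subr0.
have [z [g1 [g2 [hg1 hg2 gE]]]] := holo_decomp hg.
have [|p1 Ip1] := IHm i.+1 j g1 _ hg1; first by rewrite -eq_n addSn addnS.
have [|p2 Ip2] := IHm i j.+1 g2 _ hg2; first by rewrite -eq_n !addnS.
exists (lineX a.1 ^+ i * lineY a.2 ^+ j * z%:P%:P + p1 + p2).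
apply: (gi_near (giD Ip1 Ip2)); apply: near_imp gE => x ->.
by rewrite !evD !evM !ev_exp ev_lineX ev_lineY evC !exprS; ring.
Qed.

Lemma ev_decomp (s : R2) : exists s1 s2 : R2,
  s = (ev s a)%:P%:P + lineX a.1 * s1 + lineY a.2 * s2.
Proof.
have [s2 s2E] : exists s2, s - (s.[a.2%:P])%:P = s2 * ('X - a.2%:P%:P).
  by apply/factor_theorem/rootP; rewrite !hornerE subrr.
have [s1 s1E] : exists s1, s.[a.2%:P] - (ev s a)%:P = s1 * ('X - a.1%:P).
  by apply/factor_theorem/rootP; rewrite !hornerE subrr.
exists s1%:P, s2; rewrite /lineX /lineY -polyCM ['X - a.1%:P]lock mulrC -lock -s1E.
by rewrite polyCB addrC [X in _ + X]addrC subrK [_ * s2]mulrC -s2E subrK.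
Qed.

(** Write s = s(a) + nu with nu in the maximal ideal. Then nu^(2n) h lies in I, and s(a) nu^m h =
    nu^m s h - nu^(m+1) h lowers the exponent to 0. *)
Lemma gi_unit (s : R2) h : ev s a != 0 -> holo_at a h ->
  I (fun x => ev s x * h x) -> I h.
Proof.
move=> s0 hh Ish; have [s1 [s2 sE]] := ev_decomp s.
pose nu := lineX a.1 * s1 + lineY a.2 * s2.
have sE' x : ev s x = ev s a + ev nu x by rewrite {1}sE -addrA evD evC.
have nuE x : ev nu x = (x.1 - a.1) * ev s1 x + (x.2 - a.2) * ev s2 x.
  by rewrite evD !evM ev_lineX ev_lineY.
have nil m i j g : (i + j + m)%N = n.*2 -> holo_at a g ->
    I (fun x => (x.1 - a.1) ^+ i * (x.2 - a.2) ^+ j * (ev nu x ^+ m * g x)).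
  elim: m i j g => [|m IHm] i j g eq_n hg.
    have le_n : (n.*2 <= i + j)%N by rewrite -eq_n addn0.
    by apply: (gi_eq (gi_monomial le_n hg)) => x; rewrite expr0 mul1r.
  have E1 : (i.+1 + j + m)%N = n.*2 by rewrite -eq_n addSn addnS.
  have E2 : (i + j.+1 + m)%N = n.*2 by rewrite -eq_n !addnS.
  apply: (gi_eq (giD (IHm _ _ _ E1 (holo_mul_ev s1 hg)) (IHm _ _ _ E2 (holo_mul_ev s2 hg)))).
  by move=> x; rewrite !exprS nuE; ring.
have down m : I (fun x => ev nu x ^+ m * h x) -> I h.
  elim: m => [|m IHm] Im; first by apply: (gi_eq Im) => x; rewrite expr0 mul1r.
  apply: IHm; have Im' := gi_mul_ev (nu ^+ m) Ish.
  apply: (gi_eq (giZ (ev s a)^-1 (giD Im' (giZ (-1) Im)))) => x.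
  by rewrite (sE' x) ev_exp exprS; field.
apply: (down n.*2); apply: (gi_eq (nil n.*2 0%N 0%N h (add0n _) hh)) => x.
by rewrite !expr0 !mul1r.
Qed.

End GermIdeals.

(** * Independent classes counted by the local index *)

Section LocalIndex.
Variable R : realType.
Local Notation C := (Cplx R).
Import numFieldNormedType.Exports.
Local Open Scope classical_set_scope.
Local Notation R2 := {poly {poly C}}.
Variable a : C * C.

(* If H vanished at a, it would have zeros other than a arbitrarily close to a,
   at which powers of both coordinates vanish, being in (P, Q). *)
Lemma common_factor_unit (P Q H c c' : R2) (n : nat) :
    germ_codim a (germ_ideal2 a (ev P) (ev Q)) n ->
    P = H * c -> Q = H * c' -> ev H a != 0.
Proof.
move=> codim_n def_P def_Q; apply/negP => /eqP Ha.
have h1 := holo_const a 1.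
have [u1 [v1 [_ _ E1]]] := gi_nilpotent codim_n (coordinate1 a) h1.
have [u2 [v2 [_ _ E2]]] := gi_nilpotent codim_n (coordinate2 a) h1.
have /near_boxP[e e0 boxE] := near_and (fun x A B => conj A B) E1 E2.
have [b [ne_ba b1 b2 Hb]] := zeros_not_isolated e0 Ha.
have [] := boxE b b1 b2; rewrite !def_P !def_Q !evM Hb !(mul0r, mulr0) addr0 !mulr1.
move=> /eqP; rewrite expf_eq0 subr_eq0 => /andP[_ /eqP eq1].
move=> /eqP; rewrite expf_eq0 subr_eq0 => /andP[_ /eqP eq2].
by case/eqP: ne_ba; rewrite [b]surjective_pairing [a]surjective_pairing eq1 eq2.
Qed.

(* The classes of the al X + be Y fill (X, Y)/(P, Q) modulo which O_a has
   codimension q in O_a/(P, Q), whence p - q independent ones. *)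
Lemma independent_combinations (P Q X Y : R2) (p q : nat) :
    germ_codim a (germ_ideal2 a (ev P) (ev Q)) p ->
    germ_codim a (germ_ideal2 a (ev X) (ev Y)) q ->
  exists al be : 'I_(p - q) -> R2, forall c : 'I_(p - q) -> C,
    germ_ideal2 a (ev P) (ev Q)
      (ev ((\sum_l (c l)%:P%:P * al l) * X + (\sum_l (c l)%:P%:P * be l) * Y)) ->
    forall l, c l = 0.
Proof.
move=> codim_p codim_q; have [e [he basis]] := codim_p; have [e' [he' basis']] := codim_q.
have /choice[m Im] i : exists m : 'rV[C]_q,
    germ_ideal2 a (ev X) (ev Y) (fun x => e i x - \sum_j m ord0 j * e' j x).
  by have [m [Im _]] := basis' _ (he i); exists m.
pose M : 'M[C]_(p, q) := \matrix_(i, j) m i ord0 j.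
(* The rows of [K] give combinations of the [e i] that vanish modulo (X, Y); the first [p - q] of
   them are kept. *)
pose K := row_base (kermx M).
have rank_K : (p - q <= \rank (kermx M))%N.
  by rewrite mxrank_ker leq_sub2l // rank_leq_col.
pose w (l : 'I_(p - q)) := widen_ord rank_K l.
pose h l x := \sum_i K (w l) i * e i x.
have hh l : holo_at a (h l) by apply: holo_sum => i; apply: holoZ.
have KM : K *m M = 0 by apply/sub_kermxP; rewrite eq_row_base.
have Ih l : germ_ideal2 a (ev X) (ev Y) (h l).
  apply: (gi_eq (gi_sum (fun i => giZ (K (w l) i) (Im i)))) => x.
  under eq_bigr do rewrite mulrBr.
  rewrite sumrB [X in _ - X](_ : _ = 0) ?subr0 //.
  under eq_bigr do rewrite mulr_sumr.
  rewrite exchange_big big1 //= => j _.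
  transitivity ((\sum_i K (w l) i * M i j) * e' j x).
    by rewrite mulr_suml; apply: eq_bigr => i _; rewrite [M i j]mxE mulrA.
  have := congr1 (fun A : 'M[C]_(_, q) => A (w l) j) KM.
  rewrite [in LHS]mxE [in RHS]mxE => ->.
  by rewrite mul0r.
have comb l : exists ab : R2 * R2, germ_ideal2 a (ev P) (ev Q)
    (fun x => h l x - ev (ab.1 * X + ab.2 * Y) x).
  have [u [v [hu hv hE]]] := Ih l.
  (* Modulo (P, Q) the holomorphic coefficients may be replaced by polynomials. *)
  have [al Ial] := gi_poly codim_p hu; have [be Ibe] := gi_poly codim_p hv.
  exists (al, be).
  apply: (gi_near (giD (gi_mul_ev X Ial) (gi_mul_ev Y Ibe))).
  apply: near_imp hE => x ->; rewrite /= evD !evM; ring.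
have {comb} [ab Iab] := choice comb.
exists (fun l => (ab l).1), (fun l => (ab l).2) => c Ic.
have Ich : germ_ideal2 a (ev P) (ev Q) (fun x => \sum_l c l * h l x).
  apply: (gi_eq (giD (gi_sum (fun l => giZ (c l) (Iab l))) Ic)) => x.
  have ev_sum (F : 'I_(p - q) -> R2) : ev (\sum_l F l) x = \sum_l ev (F l) x.
    by apply: (big_morph (fun r => ev r x)) => [r1 r2|]; rewrite ?evD // /ev !horner0.
  under eq_bigr do rewrite mulrBr.
  rewrite sumrB evD !evM !ev_sum !mulr_suml -big_split /=.
  rewrite [X in _ - X + _](_ : _ = \sum_l (ev ((c l)%:P%:P * (ab l).1) x * ev X x
    + ev ((c l)%:P%:P * (ab l).2) x * ev Y x)) ?subrK //.
  by apply: eq_bigr => l _; rewrite evD !evM !evC; ring.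
(* The coordinates of the combination in the basis [e]; uniqueness for the zero germ makes them
   vanish, and the rows of [K] are free. *)
pose d : 'rV[C]_p := \row_i \sum_l c l * K (w l) i.
have d0 : d = 0.
  have [z [Iz z_unique]] := basis _ (holo_const a 0).
  have z0 : z = 0.
    apply: z_unique; apply: (gi_eq (gi0 _ _ _)) => x.
    by rewrite big1 ?subr0 // => i _; rewrite mxE mul0r.
  have : z = - d.
    apply: z_unique; apply: (gi_eq Ich) => x; rewrite sub0r -sumrN.
    under eq_bigr do rewrite mulr_sumr.
    rewrite exchange_big; apply: eq_bigr => i _; rewrite !mxE mulNr opprK mulr_suml.
    by apply: eq_bigr => l _; rewrite mulrA.
  by move/eqP; rewrite z0 eq_sym oppr_eq0 => /eqP.
pose c' : 'rV[C]_(\rank (kermx M)) := \row_j (if insub (val j) is Some l then c l else 0).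
have c'K : c' *m K = 0.
  rewrite -d0; apply/rowP => i; rewrite !mxE.
  rewrite (bigID (fun j : 'I_(\rank (kermx M)) => (j < p - q)%N)) /= [X in _ + X]big1 ?addr0.
    rewrite (big_ord_narrow rank_K); apply: eq_bigr => l _.
    by rewrite mxE /= valK.
  by move=> j /negPf lt_j; rewrite mxE insubF // mul0r.
have c'0 : c' = 0.
  have free_K : row_free K by apply: row_base_free.
  by apply: (row_free_inj free_K); rewrite c'K mul0mx.
move=> l; have := congr1 (fun A : 'rV[C]_(\rank (kermx M)) => A ord0 (w l)) c'0.
by rewrite !mxE /= valK.
Qed.

End LocalIndex.

(** * Passage from [mpoly] to k[x][y], and Jacobians of linear combinations *)

Lemma det2 (A : comNzRingType) (T : 'M[A]_2) :
  \det T = T ord0 ord0 * T ord_max ord_max - T ord0 ord_max * T ord_max ord0.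
Proof.
rewrite (expand_det_row _ ord0) !big_ord_recl big_ord0 addr0.
rewrite /cofactor !det_mx11 !mxE expr0 mul1r expr1 mulN1r mulrN.
have e1 : lift ord0 ord0 = ord_max :> 'I_2 by apply: val_inj.
have e0 : lift ord_max ord0 = ord0 :> 'I_2 by apply: val_inj.
by rewrite !e1 !e0.
Qed.

Section MpolyTransport.
Variable k : closedFieldType.
Local Notation R2 := {poly {poly k}}.
Local Notation mpoly2 := (mpoly 2 k).
Implicit Types p q : mpoly2.

Definition const2 : {rmorphism k -> R2} := polyC \o polyC.

Definition coord2 (i : 'I_2) : R2 := if i == ord0 then 'X%:P else 'X.

Definition to_poly2 : mpoly2 -> R2 := mmap const2 coord2.

Lemma to_poly2B p q : to_poly2 (p - q) = to_poly2 p - to_poly2 q.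
Proof. exact: raddfB. Qed.

Lemma to_poly2M p q : to_poly2 (p * q) = to_poly2 p * to_poly2 q.
Proof. exact: rmorphM. Qed.

Lemma to_poly2Z c p : to_poly2 (c *: p) = c%:P%:P * to_poly2 p.
Proof. by rewrite -mul_mpolyC to_poly2M /to_poly2 mmapC. Qed.

Lemma ev_sum (I : Type) (r : seq I) (P : pred I) (F : I -> R2) x :
  ev (\sum_(i <- r | P i) F i) x = \sum_(i <- r | P i) ev (F i) x.
Proof.
by apply: (big_morph (fun u => ev u x)) => [u v|]; rewrite ?evD // /ev !horner0.
Qed.

Lemma ev_to_poly2 p x : ev (to_poly2 p) x = peval p x.
Proof.
rewrite /to_poly2 /peval /meval /mmap ev_sum; apply: eq_bigr => m _.
rewrite evM evC /mmap1 !big_ord_recl !big_ord0 !mulr1 evM !ev_exp /=.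
by rewrite /ev /coord2 /= !hornerE.
Qed.

Lemma tle_const2 (c : k) : tle 0 (c%:P%:P : R2).
Proof.
by move=> [|i] [|j] //=; rewrite coefC /= ?coef0 // coefC.
Qed.

Lemma tle_exp n (p : R2) m : tle n p -> tle (n * m) (p ^+ m).
Proof.
move=> tp; elim: m => [|m IHm]; first by rewrite muln0; apply: tle_const2.
by rewrite mulnS exprS; apply: tleM.
Qed.

Lemma tle_coord2 i : tle 1 (coord2 i).
Proof.
rewrite /coord2; case: ifP => _ i' j lt_j.
  rewrite coefC; case: i' lt_j => [|i'] lt_j /=; rewrite ?coef0 // coefX.
  by case: j lt_j => [|[|j]].
rewrite coefX; case: i' lt_j => [|[|i']] lt_j /=; rewrite ?coef0 //.
by rewrite coef1; case: j lt_j.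
Qed.

Lemma tle_to_poly2 n p : (msize p <= n.+1)%N -> tle n (to_poly2 p).
Proof.
move=> le_p; rewrite /to_poly2 /mmap big_seq.
elim/big_ind: _ => [|u v|m m_p]; [exact: tle0|exact: tleD|].
have le_m : (mdeg m <= n)%N by rewrite -ltnS (leq_trans (msize_mdeg_lt m_p)).
apply: (tleW le_m); rewrite -[mdeg m]add0n; apply: tleM; first exact: tle_const2.
rewrite mdegE /mmap1 !big_ord_recl !big_ord0 addn0 mulr1.
by apply: tleM; rewrite -[X in tle X _]mul1n; apply/tle_exp/tle_coord2.
Qed.

Lemma msize_mderiv i n p : (msize p <= n.+1)%N -> (msize (mderiv i p) <= n.-1.+1)%N.
Proof.
move=> le_p; rewrite msizeE; apply/bigmax_leqP_seq => m + _.
rewrite mcoeff_msupp mcoeff_deriv => m_p; rewrite ltnS.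
have : mnm_add m (mnm1 i) \in msupp p.
  by rewrite mcoeff_msupp; apply: contraNneq m_p => ->; rewrite mul0rn.
move/msize_mdeg_lt; rewrite mdegD mdeg1 addn1 => lt_m.
by move: (leq_trans lt_m le_p); case: n {le_p}.
Qed.

Lemma msizeM_leq m n p q : (msize p <= m.+1)%N -> (msize q <= n.+1)%N ->
  (msize (p * q) <= (m + n).+1)%N.
Proof.
have [->|p0] := eqVneq p 0; first by rewrite mul0r msize0.
have [->|q0] := eqVneq q 0; first by rewrite mulr0 msize0.
move=> le_p le_q; rewrite msizeM // -subn1 leq_subLR add1n.
by apply: leq_trans (leq_add le_p le_q) _; rewrite addSn addnS.
Qed.

Lemma msizeB_leq n p q : (msize p <= n)%N -> (msize q <= n)%N -> (msize (p - q) <= n)%N.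
Proof.
by move=> le_p le_q; rewrite (leq_trans (msizeD_le _ _)) // geq_max msizeN le_p.
Qed.

Lemma msize_Jac m n (F : polymap k) :
  (msize F.1 <= m.+1)%N -> (msize F.2 <= n.+1)%N ->
  (msize (Jac F) <= (m.-1 + n.-1).+1)%N.
Proof.
by move=> le1 le2; apply: msizeB_leq; apply: msizeM_leq; apply: msize_mderiv.
Qed.

Lemma Jac_lincomp (T : 'M[k]_2) (F : polymap k) :
  Jac (lincomp T F) = \det T *: Jac F.
Proof.
rewrite det2 /Jac /lincomp /dx /dy /= !mderivD !mderivZ.
by rewrite -!mul_mpolyC mpolyCB !mpolyCM; ring.
Qed.

(** Next to a general first component, either component of [F] may serve as the second: the Jacobian
    only changes by a scalar. This makes the lower degree available. *)
Lemma Jac_lincomp1 (T : 'M[k]_2) (F : polymap k) :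
  Jac ((lincomp T F).1, F.2) = T ord0 ord0 *: Jac F.
Proof.
by rewrite /Jac /lincomp /dx /dy /= !mderivD !mderivZ -!mul_mpolyC; ring.
Qed.

Lemma Jac_lincomp2 (T : 'M[k]_2) (F : polymap k) :
  Jac ((lincomp T F).1, F.1) = - T ord0 ord_max *: Jac F.
Proof.
by rewrite /Jac /lincomp /dx /dy /= !mderivD !mderivZ -!mul_mpolyC mpolyCN; ring.
Qed.

Lemma to_poly2_Jac (F : polymap k) : to_poly2 (Jac F) =
  to_poly2 (dx F.1) * to_poly2 (dy F.2) - to_poly2 (dy F.1) * to_poly2 (dx F.2).
Proof. by rewrite to_poly2B !to_poly2M. Qed.

Lemma to_poly2_Jac11 (F : polymap k) : to_poly2 (Jac11 F) =
  to_poly2 (dx (Jac F)) * to_poly2 (dy F.1) - to_poly2 (dy (Jac F)) * to_poly2 (dx F.1).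
Proof. by rewrite to_poly2B !to_poly2M. Qed.

End MpolyTransport.

(** * Existence of general matrices *)

Lemma digits_inj (D n : nat) (f g : 'I_n -> nat) :
    (forall i, f i < D)%N -> (forall i, g i < D)%N ->
    (\sum_(i < n) f i * D ^ i = \sum_(i < n) g i * D ^ i)%N -> f =1 g.
Proof.
elim: n f g => [|n IHn] f g lt_f lt_g; first by move=> _ [].
have recl h : (\sum_(i < n.+1) h i * D ^ i
    = (\sum_(i < n) h (lift ord0 i) * D ^ i) * D + h ord0)%N.
  rewrite big_ord_recl expn0 muln1 addnC big_distrl /=; congr (_ + _)%N.
  by apply: eq_bigr => i _; rewrite /bump expnS -mulnA (mulnC D).
have D0 : (0 < D)%N by apply: leq_ltn_trans (lt_f ord0).
rewrite !recl => eq_fg.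
have eq0 : f ord0 = g ord0.
  by have := congr1 (modn^~ D) eq_fg; rewrite /= !modnMDl !modn_small.
have eqS : (\sum_(i < n) f (lift ord0 i) * D ^ i = \sum_(i < n) g (lift ord0 i) * D ^ i)%N.
  by have := congr1 (divn^~ D) eq_fg; rewrite /= !divnMDl // !divn_small // !addn0.
have fgS := IHn (fun i => f (lift ord0 i)) (fun i => g (lift ord0 i))
  (fun i => lt_f _) (fun i => lt_g _) eqS.
by move=> i; have [j ->|->] := unliftP ord0 i; [apply: fgS|].
Qed.

Lemma poly_nonroot (k : numFieldType) (p : {poly k}) : p != 0 -> exists t, p.[t] != 0.
Proof.
move=> p0; apply: contrapT => /forallNP all_root.
pose s : seq k := [seq i%:R | i <- iota 0 (size p)].
have : (size s < size p)%N.
  apply: max_poly_roots => //.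
    by apply/allP => t _; apply/rootP/eqP/negPn/negP/all_root.
  rewrite map_inj_uniq ?iota_uniq // => i j /eqP.
  by rewrite eqr_nat => /eqP.
by rewrite size_map size_iota ltnn.
Qed.

(* Kronecker substitution: distinct monomials of p become distinct powers of t
   under x_i = t ^ (D ^ i) once D exceeds all exponents. *)
Lemma mpoly_nonroot (k : numFieldType) n (p : mpoly n k) :
  p != 0 -> exists v, meval v p != 0.
Proof.
move=> p0; pose D := msize p.
pose kr (m : multinom n) := (\sum_(i < n) m i * D ^ i)%N.
have digit m : m \in msupp p -> forall i, (m i < D)%N.
  move=> m_p i; apply: leq_ltn_trans (msize_mdeg_lt m_p).
  by rewrite mdegE (bigD1 i) //= leq_addr.
pose P : {poly k} := \sum_(m <- msupp p) mcoeff m p *: 'X^(kr m).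
have P0 : P != 0.
  have m_p := mlead_supp p0; set m0 := mlead p in m_p.
  suff : P`_(kr m0) != 0 by apply: contraNneq => ->; rewrite coef0.
  rewrite coef_sum (bigD1_seq m0) ?msupp_uniq //= big_seq_cond big1 ?addr0.
    by rewrite coefZ coefXn eqxx mulr1 -mcoeff_msupp.
  move=> m /andP[m'_p ne_m]; rewrite coefZ coefXn.
  case: eqP => [eq_kr|]; last by rewrite mulr0.
  case/eqP: ne_m; apply/mnmP => i.
  by apply: (digits_inj (digit m m'_p) (digit m0 m_p)).
have [t Pt] := poly_nonroot P0; exists (fun i => t ^+ (D ^ i)%N).
suff -> : meval (fun i : 'I_n => t ^+ (D ^ i)%N) p = P.[t] by [].
rewrite /meval /mmap /P horner_sum; apply: eq_bigr => m _.
rewrite hornerZ hornerXn /mmap1; congr (_ * _).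
rewrite /kr expr_sum; apply: eq_bigr => i _.
by rewrite -exprM mulnC.
Qed.

(** Multiply the given polynomials by the determinant and the entries of the first row, and take a
    point where this nonzero product does not vanish. *)
Lemma general_matrix (k : numFieldType) (I : finType) (q : I -> mpoly (2 * 2) k) :
  (forall i, q i != 0) -> exists T : 'M[k]_2, [/\ T \in unitmx,
    T ord0 ord0 != 0, T ord0 ord_max != 0 &
    forall i, meval (fun j => mxvec T ord0 j) (q i) != 0].
Proof.
move=> q0.
pose x (i j : 'I_2) : mpoly (2 * 2) k := mpolyX k (mnm1 (mxvec_index i j)).
pose mat (v : 'I_(2 * 2) -> k) : 'M[k]_2 := vec_mx (\row_j v j).
have ev_x v i j : meval v (x i j) = mat v i j.
  by rewrite /x mevalXU /mat !mxE.
pose dt := x ord0 ord0 * x ord_max ord_max - x ord0 ord_max * x ord_max ord0.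
have nz (r : mpoly (2 * 2) k) v : meval v r != 0 -> r != 0.
  by apply: contraNneq => ->; rewrite meval0.
pose vec (A : 'M[k]_2) j := mxvec A ord0 j.
have matK A : mat (vec A) = A.
  by apply/matrixP => i j; rewrite -ev_x /x mevalXU /vec mxvecE.
have x0 i j : x i j != 0.
  by apply: (nz _ (vec (const_mx 1))); rewrite ev_x matK mxE oner_eq0.
have dt0 : dt != 0.
  apply: (nz _ (vec 1%:M)); rewrite mevalB !mevalM !ev_x !matK !mxE /=.
  by rewrite mulr0 subr0 mulr1 oner_eq0.
have : dt * x ord0 ord0 * x ord0 ord_max * \prod_i q i != 0.
  by rewrite !mulf_neq0 //; apply/prodf_neq0 => i _.
move=> /mpoly_nonroot[v]; rewrite !mevalM rmorph_prod !mulf_eq0 !negb_or /=.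
rewrite !ev_x => /andP[/andP[/andP[dt_v T00] T01] /prodf_neq0 qv].
exists (mat v); split=> // [|i].
  rewrite unitmxE unitfE det2; move: dt_v.
  by rewrite mevalB !mevalM !ev_x.
rewrite (meval_eq (v2 := v)); first exact: qv.
by move=> j; rewrite /mat vec_mxK mxE.
Qed.

(** * The gradient matrix and the sum of the indices *)

Definition row_degree (m n : nat) (i : 'I_3) : nat :=
  match val i with 0 => m.-1 | 1 => n.-1 | _ => (m.-1 + n.-1).-1 end.

(* The rows are the gradients of f, g and J(F), rotated so that their products
   with (f_x, f_y) are 0, J(f, g) and J_{1,1}(F). *)
Lemma gradient_rows (k : closedFieldType) (g : mpoly 2 k) (F : polymap k)
    (z : k) (m n : nat) :
    z != 0 -> Jac (F.1, g) = z *: Jac F ->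
    (msize F.1 <= m.+1)%N -> (msize g <= n.+1)%N ->
  exists ra rb : 'I_3 -> {poly {poly k}},
  [/\ forall i, tle (row_degree m n i) (ra i),
      forall i, tle (row_degree m n i) (rb i),
      cross ra rb o1 = - to_poly2 (Jac11 F) /\
      cross ra rb o2 = z%:P%:P * to_poly2 (Jac F) &
      forall i, exists c d, ra i * to_poly2 (dx F.1) + rb i * to_poly2 (dy F.1) =
        c * to_poly2 (Jac F) + d * to_poly2 (Jac11 F)].
Proof.
move=> z0 JacE le_m le_n.
have QE := to_poly2_Jac11 F.
have PE := to_poly2_Jac (F.1, g); rewrite JacE to_poly2Z /= in PE.
have le_J : (msize (Jac F) <= (m.-1 + n.-1).+1)%N.
  by rewrite -(msizeZ _ z0) -JacE; apply: msize_Jac.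
have deg_dx s d : (msize s <= d.+1)%N -> tle d.-1 (to_poly2 (dx s)).
  by move=> le_s; apply/tle_to_poly2/msize_mderiv.
have deg_dy s d : (msize s <= d.+1)%N -> tle d.-1 (to_poly2 (dy s)).
  by move=> le_s; apply/tle_to_poly2/msize_mderiv.
have deg_a : [/\ tle m.-1 (to_poly2 (dy F.1)), tle n.-1 (to_poly2 (dy g)) &
    tle (m.-1 + n.-1).-1 (to_poly2 (dy (Jac F)))] by split; apply: deg_dy.
have deg_b : [/\ tle m.-1 (to_poly2 (dx F.1)), tle n.-1 (to_poly2 (dx g)) &
    tle (m.-1 + n.-1).-1 (to_poly2 (dx (Jac F)))] by split; apply: deg_dx.
move: (to_poly2 (dx F.1)) (to_poly2 (dy F.1)) (to_poly2 (dx g)) (to_poly2 (dy g))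
  (to_poly2 (dx (Jac F))) (to_poly2 (dy (Jac F))) (to_poly2 (Jac F))
  (to_poly2 (Jac11 F)) QE PE deg_a deg_b.
move=> X Y gx gy Jx Jy P Q QE PE [a0 a1 a2] [b0 b1 b2].
exists (fun i : 'I_3 => match val i with 0 => Y | 1 => gy | _ => - Jy end).
exists (fun i : 'I_3 => match val i with 0 => - X | 1 => - gx | _ => Jx end).
split.
- by apply: ord3P => //; apply: tleN.
- by apply: ord3P => //; apply: tleN.
- by rewrite /cross /= QE PE; split; ring.
apply: ord3P => /=.
- by exists 0, 0; ring.
- by exists z%:P%:P, 0; rewrite PE; ring.
by exists 0, 1; rewrite QE; ring.
Qed.

(** Outside [S] the relation [U] is total and the count is 0. At a point of [S], a common factor of
    the minors [o1] and [o2] divides both P and Q, hence is a unit there. *)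
Lemma rows_index_bound (R : realType) (X Y P Q : {poly {poly Cplx R}})
    (ra rb : 'I_3 -> {poly {poly Cplx R}}) (z : Cplx R) (e : 'I_3 -> nat)
    (r : nat) (a : 'I_r -> Cplx R * Cplx R) (S : pred 'I_r) (p q : 'I_r -> nat) :
    injective a -> z != 0 -> (forall i, tle (e i) (ra i)) -> (forall i, tle (e i) (rb i)) ->
    cross ra rb o1 = - Q -> cross ra rb o2 = z%:P%:P * P ->
    (forall i, exists c d, ra i * X + rb i * Y = c * P + d * Q) ->
    (forall i, S i -> germ_codim (a i) (germ_ideal2 (a i) (ev P) (ev Q)) (p i)) ->
    (forall i, S i -> germ_codim (a i) (germ_ideal2 (a i) (ev X) (ev Y)) (q i)) ->
  (\sum_i (if S i then p i - q i else 0) <= e o0 * e o1 + e o0 * e o2 + e o1 * e o2)%N.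
Proof.
move=> a_inj z0 deg_a deg_b cr1 cr2 rowE codimP codimX.
have zK : z^-1%:P%:P * z%:P%:P = 1 :> {poly {poly Cplx R}}.
  by rewrite -polyCM -polyCM mulVf.
pose I i := germ_ideal2 (a i) (ev P) (ev Q).
have I_gen i c d : I i (ev (c * P + d * Q)).
  exists (ev c), (ev d); split; [exact: holo_ev|exact: holo_ev|].
  by apply: near_all => x; rewrite evD !evM.
pose U i u v := S i -> I i (ev (u * X + v * Y)).
have UM i c u v : U i u v -> U i (c * u) (c * v).
  move=> Uuv /Uuv Iuv; apply: (gi_eq (gi_mul_ev c Iuv)) => x.
  by rewrite -evM mulrDr !mulrA.
have unit_div i s u v : S i -> ev s (a i) != 0 -> U i (s * u) (s * v) -> U i u v.
  move=> Si s0 /(_ Si) Isuv _; apply: (gi_unit (codimP i Si) s0 (holo_ev _ _)).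
  by apply: (gi_eq Isuv) => x; rewrite -evM mulrDr !mulrA.
apply: (@many_points_bound (Cplx R) 'I_r a e ra rb U).
- exact: a_inj.
- exact: deg_a.
- exact: deg_b.
- move=> i u v u' v' Uuv Uuv' Si.
  apply: (gi_eq (giD (Uuv Si) (Uuv' Si))) => x.
  by rewrite -evD !mulrDl addrACA.
- exact: UM.
- by move=> i j Si; have [c [d ->]] := rowE j; apply: I_gen.
- by move=> i s u v s0 Usuv Si; apply: (unit_div i s u v Si s0 Usuv Si).
- move=> i H c c' HQ HP u v UHuv Si; apply: (unit_div i H u v Si _ UHuv Si).
  apply: (common_factor_unit (c := z^-1%:P%:P * c') (c' := - c) (codimP i Si)).
    by rewrite mulrCA -HP cr2 mulrA zK mul1r.
  by rewrite mulrN -HQ cr1 opprK.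
- move=> i; exists (p i) => u v; split=> Si.
    have huv := holo_ev (a i) (u * X + v * Y).
    apply: (gi_eq (gi_nilpotent (codimP i Si) (coordinate1 (a i)) huv)).
    by move=> x; rewrite -ev_lineX -ev_exp -evM mulrDr !mulrA.
  have huv := holo_ev (a i) (u * X + v * Y).
  apply: (gi_eq (gi_nilpotent (codimP i Si) (coordinate2 (a i)) huv)).
  by move=> x; rewrite -ev_lineY -ev_exp -evM mulrDr !mulrA.
move=> i; rewrite /U; case: ifPn => [Si|_]; last first.
  by exists (fun=> 0), (fun=> 0) => c _ [].
have [al [be indep]] := independent_combinations (codimP i Si) (codimX i Si).
by exists al, be => c /(_ isT); apply: indep.
Qed.

Lemma germ_codim_peval (R : realType) (a : Cplx R * Cplx R) (s t : mpoly 2 (Cplx R)) n :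
  germ_codim a (germ_ideal2 a (peval s) (peval t)) n ->
  germ_codim a (germ_ideal2 a (ev (to_poly2 s)) (ev (to_poly2 t))) n.
Proof.
have evE (u : mpoly 2 (Cplx R)) : ev (to_poly2 u) = peval u.
  by apply/funext => x; rewrite ev_to_poly2.
by have -> : germ_ideal2 a (ev (to_poly2 s)) (ev (to_poly2 t))
  = germ_ideal2 a (peval s) (peval t) by congr germ_ideal2; apply: evE.
Qed.

Lemma index_sum_bound (R : realType) (g : mpoly 2 (Cplx R)) (F : polymap (Cplx R))
    (z : Cplx R) (m n r : nat) (a : 'I_r -> Cplx R * Cplx R) (S : pred 'I_r)
    (p q : 'I_r -> nat) :
    z != 0 -> Jac (F.1, g) = z *: Jac F ->
    (msize F.1 <= m.+1)%N -> (msize g <= n.+1)%N -> injective a ->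
    (forall i, S i -> germ_codim (a i)
       (germ_ideal2 (a i) (peval (Jac F)) (peval (Jac11 F))) (p i)) ->
    (forall i, S i -> germ_codim (a i)
       (germ_ideal2 (a i) (peval (dx F.1)) (peval (dy F.1))) (q i)) ->
  (\sum_i (if S i then p i - q i else 0) <=
    m.-1 * n.-1 + m.-1 * (m.-1 + n.-1).-1 + n.-1 * (m.-1 + n.-1).-1)%N.
Proof.
move=> z0 JacE le_m le_n a_inj codim_p codim_q.
have [ra [rb [deg_a deg_b [cr1 cr2] rowE]]] := gradient_rows z0 JacE le_m le_n.
exact: (rows_index_bound a_inj z0 deg_a deg_b cr1 cr2 rowE
  (fun i Si => germ_codim_peval (codim_p i Si))
  (fun i Si => germ_codim_peval (codim_q i Si))).
Qed.

(** * A common general [T] for all cusps, and the final inequality *)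

Unset Implicit Arguments.

Theorem corollary5p7 (R : realType) (d1 d2 : nat) (hd1 : (1 <= d1)%N)
    (hd2 : (1 <= d2)%N) (F : polymap (Cplx R)) (hF : Omega2 d1 d2 F)
    (r : nat) (a : 'I_r -> Cplx R * Cplx R) (ha : injective a)
    (hcusp : forall i, generalized_cusp F (a i)) :
  \sum_(i < r) cusp_index F (a i) <=
    d1%:Z ^+ 2 + d2%:Z ^+ 2 + 3 * d1%:Z * d2%:Z - 6 * d1%:Z - 6 * d2%:Z + 7.
Proof.
have [le1 le2] := hF.
(* Where no index exists, [cusp_index] takes its default value 0; such points are set aside. *)
pose S : pred 'I_r := fun i => `[< exists m, has_index F (a i) m >].
have index0 i : ~~ S i -> cusp_index F (a i) = 0.
  move=> /asboolPn no_index; rewrite /cusp_index xgetPN // => m m_index.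
  by apply: no_index; exists m.
have indexP i : S i -> has_index F (a i) (cusp_index F (a i)).
  by move=> /asboolP[m m_index]; apply: (xgetPex 0); exists m.
have /choice[q q_spec] i : exists q : mpoly (2 * 2) (Cplx R), q != 0 /\
    (S i -> forall T : 'M_2, T \in unitmx -> meval (fun j => mxvec T ord0 j) q != 0 ->
      exists p0 q0 : nat,
        [/\ germ_codim (a i) (germ_ideal2 (a i) (peval (Jac (lincomp T F)))
              (peval (Jac11 (lincomp T F)))) p0,
            germ_codim (a i) (germ_ideal2 (a i) (peval (dx (lincomp T F).1))
              (peval (dy (lincomp T F).1))) q0 &
            cusp_index F (a i) = p0%:Z - q0%:Z]).
  have [Si|_] := boolP (S i); last by exists 1; rewrite oner_eq0.
  by have [q q0 q_gen] := indexP i Si; exists q.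
(* One [T] serves all points; the nonzero entries of its first row keep both components of [F]
   available as partner of the general one. *)
have [T [T_unit T00 T01 qT]] := general_matrix (fun i => (q_spec i).1).
pose F' := lincomp T F.
have /choice[pq pq_spec] i : exists pq : nat * nat, S i ->
    [/\ germ_codim (a i) (germ_ideal2 (a i) (peval (Jac F')) (peval (Jac11 F'))) pq.1,
        germ_codim (a i) (germ_ideal2 (a i) (peval (dx F'.1)) (peval (dy F'.1))) pq.2 &
        cusp_index F (a i) = pq.1%:Z - pq.2%:Z].
  have [Si|_] := boolP (S i); last by exists (0, 0)%N.
  by have [p0 [q0 ?]] := (q_spec i).2 Si T T_unit (qT i); exists (p0, q0).
(* The truncated difference of naturals is at least the integer one. *)
have sum_le : \sum_(i < r) cusp_index F (a i)
    <= (\sum_i (if S i then (pq i).1 - (pq i).2 else 0))%N%:Z.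
  rewrite -[X in _ <= X]natz natr_sum; apply: ler_sum => i _; rewrite natz.
  by case: ifPn => [/pq_spec[_ _ ->]|/index0 -> //]; clear; lia.
apply: le_trans sum_le _.
have det0 : \det T != 0 by rewrite -unitfE -unitmxE.
have bound g m n z : z != 0 -> Jac (F'.1, g) = z *: Jac F' ->
    (msize F'.1 <= m.+1)%N -> (msize g <= n.+1)%N ->
    (\sum_i (if S i then (pq i).1 - (pq i).2 else 0) <=
      m.-1 * n.-1 + m.-1 * (m.-1 + n.-1).-1 + n.-1 * (m.-1 + n.-1).-1)%N.
  move=> z0 JacE le_m le_n; apply: (index_sum_bound z0 JacE le_m le_n ha).
    by move=> i /pq_spec[].
  by move=> i /pq_spec[].
have le_F' m : (d1 <= m)%N -> (d2 <= m)%N -> (msize F'.1 <= m.+1)%N.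
  move=> le_d1 le_d2; apply: leq_trans (msizeD_le _ _) _; rewrite geq_max.
  apply/andP; split; apply: leq_trans (msizeZ_le _ _) _.
    exact: leq_trans le1 _.
  exact: leq_trans le2 _.
(* In fact an equality: at [m = n = 1] the outer predecessor truncates, but it is multiplied by
   0. *)
have arith m n : (0 < m)%N -> (0 < n)%N ->
    (m.-1 * n.-1 + m.-1 * (m.-1 + n.-1).-1 + n.-1 * (m.-1 + n.-1).-1)%N%:Z
    <= m%:Z ^+ 2 + n%:Z ^+ 2 + 3 * m%:Z * n%:Z - 6 * m%:Z - 6 * n%:Z + 7.
  by case: m => // m; case: n => // n _ _ /=; case: m => [|m]; case: n => [|n]; nia.
(* The first component of [F'] is bounded by the larger of [d1] and [d2], so its partner is the
   component of [F] with the smaller bound. *)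
have [le21|lt12] := leqP d2 d1.
  have JacE : Jac (F'.1, F.2) = (T ord0 ord0 / \det T) *: Jac F'.
    by rewrite Jac_lincomp1 Jac_lincomp scalerA divfK.
  apply: le_trans (arith d1 d2 hd1 hd2); rewrite lez_nat.
  by apply: bound JacE _ le2; rewrite ?mulf_neq0 ?invr_eq0 //; apply: le_F'.
have JacE : Jac (F'.1, F.1) = (- T ord0 ord_max / \det T) *: Jac F'.
  by rewrite Jac_lincomp2 Jac_lincomp scalerA divfK.
apply: (le_trans (y := (d2.-1 * d1.-1 + d2.-1 * (d2.-1 + d1.-1).-1
    + d1.-1 * (d2.-1 + d1.-1).-1)%N%:Z)).
  rewrite lez_nat; apply: bound JacE _ le1; first by rewrite mulf_neq0 ?invr_eq0 ?oppr_eq0.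
  by apply: le_F' => //; apply: ltnW.
by apply: le_trans (arith d2 d1 hd2 hd1) _; rewrite le_eqVlt; apply/orP; left; apply/eqP; ring.
Qed.
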